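(* Assume Assumption A1 (stated in the context). Let $h,r,M$ be positive constants, put $\lambda=h^{2m}$, and suppose $c_K^2\sqrt{M}\,r\,h^{-1/2}A(h)\le1/2$. Then $$\sup_{f\in H^m(1)}P_f\Big(\Big\|\widehat f_{n,\lambda}-f-\Big(\frac1n\sum_{i=1}^n\epsilon_iK_{X_i}-\mathcal{P}_\lambda f\Big)\Big\|\ge\gamma_n(M,r)\Big)\le2\exp(-Mnhr^2),$$ where $\gamma_n(M,r)=c_K^2\sqrt{M}\,r\,h^{-1/2}A(h)\,\delta_n(M,r)$ and $\delta_n(M,r)=2h^m+c_K\big(\sqrt{2M}\,r+(nh)^{-1/2}\big)$.
   Context: Fix an integer $m\ge1$ and $\mathbb{I}=[0,1]$. $S^m(\mathbb{I})$ is the Sobolev space of $f\in L^2(\mathbb{I})$ such that $f^{(j)}$ is absolutely continuous for $j=0,\dots,m-1$ and $\int_0^1|f^{(m)}(x)|^2dx<\infty$. Data $(Y_i,X_i)$, $i=1,\dots,n$, are i.i.d. copies of $(Y,X)$ with $Y=f(X)+\epsilon$, where $X\sim\mathrm{Unif}[0,1]$, $\epsilon\sim N(0,1)$ is independent of $X$, and $f\in S^m(\mathbb{I})$; $P_f$ denotes probability when $f$ is the true regression function, and $\epsilon_i=Y_i-f(X_i)$. Let $J(f,g)=\int_0^1f^{(m)}(x)g^{(m)}(x)dx$ and $V(f,g)=E\{f(X)g(X)\}$. For $\lambda>0$ let $\langle f,g\rangle=V(f,g)+\lambda J(f,g)$ with norm $\|\cdot\|$; $(S^m(\mathbb{I}),\langle\cdot,\cdot\rangle)$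 is a reproducing kernel Hilbert space with kernel $K$, $K_x=K(x,\cdot)$, $\langle K_x,f\rangle=f(x)$. $\mathcal{P}_\lambda$ is the self-adjoint operator on $S^m(\mathbb{I})$ with $\langle f,\mathcal{P}_\lambda g\rangle=\lambda J(f,g)$ for all $f,g$. The smoothing spline estimator is $\widehat f_{n,\lambda}=\arg\max_{f\in S^m(\mathbb{I})}\{-\frac{1}{2n}\sum_{i=1}^n(Y_i-f(X_i))^2-\frac{\lambda}{2}J(f,f)\}$. Assumption A1: there exist $\varphi_\nu\in S^m(\mathbb{I})$, $\nu\ge1$, with $\sup_{\nu}\|\varphi_\nu\|_{\sup}<\infty$, and a nondecreasing sequence $\rho_\nu$ with $\rho_\nu/(c_\rho\nu)^{2m}\to1$ for some constant $c_\rho>0$, such that $V(\varphi_\mu,\varphi_\nu)=\delta_{\mu\nu}$, $J(\varphi_\mu,\varphi_\nu)=\rho_\mu\delta_{\mu\nu}$, and every $g\in S^m(\mathbb{I})$ satisfies $g=\sum_\nu V(g,\varphi_\nu)\varphi_\nu$ with convergence in $\|\cdot\|$. With $h=\lambda^{1/(2m)}$, let $c_K=\sup_{x\in\mathbb{I}}\sqrt{hK(x,x)}$ (finite under A1), $H^m(1)=\{f\in S^m(\mathbb{I}):J(f,f)\le1\}$, $\mathcal{G}=\{g\in S^m(\mathbb{I}):\|g\|_{\sup}\le1,\ J(g,g)\le c_K^{-2}h^{-2m+1}\}$, and let $c_0>0$ be a constant such that $\log N(\varepsilon,\mathcal{G},\|\cdot\|_{\sup})\le c_0h^{-(2m-1)/(2m)}\varepsilon^{-1/m}$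 for all $\varepsilon>0$, where $N$ is the $\varepsilon$-packing number. Let $\tau=\sqrt{\log1.5}$, $\Psi(r)=\int_0^r\sqrt{\log(1+\exp(x^{-1/m}))}\,dx$, $$A(h,\varepsilon)=\frac{32\sqrt6}{\tau}c_K^{-1}c_0^mh^{-(2m-1)/2}\Psi\Big(\tfrac12c_Kc_0^{-m}h^{(2m-1)/2}\varepsilon\Big)+\frac{20\sqrt6\,\varepsilon}{\tau}\sqrt{\log\Big(1+\exp\big(2c_0(c_Kh^{(2m-1)/2}\varepsilon)^{-1/m}\big)\Big)},$$ and $A(h)=A(h,2)$. *)

(* Defs.v *)
From HB Require Import structures.
From mathcomp Require Import all_boot all_order all_algebra.
From mathcomp Require Import all_classical all_reals all_analysis.
From mathcomp Require Import normal_distribution uniform_distribution.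

Set Implicit Arguments.
Unset Strict Implicit.
Unset Printing Implicit Defensive.

Import Order.TTheory GRing.Theory Num.Theory.
Import numFieldNormedType.Exports.

Local Open Scope classical_set_scope.
Local Open Scope ring_scope.

Definition RintI {R : realType} (a b : R) (f : R -> R) : R :=
  Rintegral (@lebesgue_measure R) `[a, b] f.

(* g j plays the role of f^(j), j = 0..m : g 0 = f on [0,1]; for j < m,
   f^(j) is absolutely continuous on [0,1] with (integrable) derivative
   f^(j+1), i.e. f^(j)(x) = f^(j)(0) + int_0^x f^(j+1); f^(m) is
   square integrable; f is in L^2. *)
Definition sobolev_rep {R : realType} (m : nat) (f : R -> R)
    (g : nat -> R -> R) : Prop :=
  [/\ (forall x, 0 <= x <= 1 -> g 0%N x = f x),
      measurable_fun `[(0:R), 1] f /\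
        (@lebesgue_measure R).-integrable `[(0:R), 1] (fun x => (f x ^+ 2)%:E),
      (forall j, (j < m)%N ->
         (@lebesgue_measure R).-integrable `[(0:R), 1] (fun x => (g j.+1 x)%:E) /\
         forall x, 0 <= x <= 1 -> g j x = g j 0 + RintI 0 x (g j.+1)) &
      measurable_fun `[(0:R), 1] (g m) /\
        (@lebesgue_measure R).-integrable `[(0:R), 1] (fun x => (g m x ^+ 2)%:E)].

Definition Sobolev {R : realType} (m : nat) (f : R -> R) : Prop :=
  exists g, sobolev_rep m f g.

(* a (choice of a) version of f^(m); a.e. unique on [0,1] *)
Definition sobD {R : realType} (m : nat) (f : R -> R) : R -> R :=
  match pselect (exists g, sobolev_rep m f g) with
  | left H => projT1 (cid H) m
  | right _ => fun _ => 0
  end.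

Definition Jf {R : realType} (m : nat) (f g : R -> R) : R :=
  RintI 0 1 (fun x => sobD m f x * sobD m g x).

(* V(f,g) = E f(X) g(X), X ~ Unif[0,1] *)
Definition Vf {R : realType} (f g : R -> R) : R :=
  RintI 0 1 (fun x => f x * g x).

Definition inner {R : realType} (m : nat) (lam : R) (f g : R -> R) : R :=
  Vf f g + lam * Jf m f g.

Definition normS {R : realType} (m : nat) (lam : R) (f : R -> R) : R :=
  Num.sqrt (inner m lam f f).

Definition supn {R : realType} (f : R -> R) : R :=
  sup [set `|f x| | x in `[(0:R), 1]].

(* ---------- Assumption A1 (phi nu here is phi_{nu+1} of the paper) ------ *)
Definition A1 {R : realType} (m : nat) (lam : R) : Prop :=
  exists (phi : nat -> R -> R) (rho : nat -> R) (crho : R),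
  0 < crho /\
      (forall nu, Sobolev m (phi nu)) /\
      (exists B : R, forall nu x, 0 <= x <= 1 -> `|phi nu x| <= B) /\
      (forall i j, (i <= j)%N -> rho i <= rho j) /\
      (fun nu : nat => rho nu / (crho * nu.+1%:R) ^+ (2 * m)) @ \oo --> (1 : R) /\
      (forall mu nu, Vf (phi mu) (phi nu) = (mu == nu)%:R) /\
      (forall mu nu, Jf m (phi mu) (phi nu) = rho mu * (mu == nu)%:R) /\
      (forall g, Sobolev m g ->
         (fun N : nat => normS m lam
            (fun x => g x - \sum_(nu < N) Vf g (phi nu) * phi nu x)) @ \oo
           --> (0 : R)).

Definition cK {R : realType} (h : R) (K : R -> R -> R) : R :=
  sup [set Num.sqrt (h * K x x) | x in `[(0:R), 1]].

Definition Gset {R : realType} (m : nat) (h ck : R) : set (R -> R) :=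
  [set g | [/\ Sobolev m g, supn g <= 1 &
               Jf m g g <= ck ^- 2 * (h ^+ (2 * m - 1))^-1]].

(* log N(eps, G, ||.||_sup) <= c0 h^{-(2m-1)/(2m)} eps^{-1/m} for all eps>0,
   N being the eps-packing number (maximal number of points of G at pairwise
   sup-distance > eps) *)
Definition packing_bound {R : realType} (m : nat) (h c0 : R)
    (G : set (R -> R)) : Prop :=
  forall eps : R, 0 < eps ->
  forall (k : nat) (g : 'I_k -> R -> R),
    (forall i, G (g i)) ->
    (forall i j, i != j -> eps < supn (fun x => g i x - g j x)) ->
    ln (k%:R : R) <=
      c0 * powR h (- ((2 * m%:R - 1) / (2 * m%:R))) * powR eps (- (m%:R^-1)).

Definition tau {R : realType} : R := Num.sqrt (ln (3 / 2)).

Definition Psi {R : realType} (m : nat) (r : R) : R :=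
  RintI 0 r (fun x => Num.sqrt (ln (1 + expR (powR x (- (m%:R^-1)))))).

Definition Afun {R : realType} (m : nat) (ck c0 h eps : R) : R :=
  32 * Num.sqrt 6 / tau * ck^-1 * c0 ^+ m
     * powR h (- ((2 * m%:R - 1) / 2))
     * Psi m (2^-1 * ck * c0 ^- m * powR h ((2 * m%:R - 1) / 2) * eps)
  + 20 * Num.sqrt 6 * eps / tau
     * Num.sqrt (ln (1 + expR (2 * c0 *
          powR (ck * powR h ((2 * m%:R - 1) / 2) * eps) (- (m%:R^-1))))).

(* the penalized log-likelihood maximized by the smoothing spline *)
Definition objective {R : realType} (m n : nat) (lam : R) (xs ys : nat -> R)
    (g : R -> R) : R :=
  - (2 * n%:R)^-1 * \sum_(i < n) (ys i - g (xs i)) ^+ 2 - lam / 2 * Jf m g g.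

Definition is_smoothing_spline {R : realType} (m n : nat) (lam : R)
    (fhat : (nat -> R) -> (nat -> R) -> R -> R) : Prop :=
  forall xs ys : nat -> R, (forall i, (i < n)%N -> 0 <= xs i <= 1) ->
    Sobolev m (fhat xs ys) /\
    forall g, Sobolev m g -> objective m n lam xs ys g <= objective m n lam xs ys (fhat xs ys).

Definition iid_model {R : realType} {d : measure_display} {T : measurableType d}
    (P : probability T R) (n : nat) (X e : nat -> T -> R) : Prop :=
  [/\ (forall i, measurable_fun setT (X i) /\ measurable_fun setT (e i)),
      (forall i A, (i < n)%N -> measurable A ->
         P (X i @^-1` A) = uniform_prob (@ltr01 R) A),
      (forall i A, (i < n)%N -> measurable A ->
         P (e i @^-1` A) = normal_prob 0 1 A) &
      (forall A B : nat -> set R, (forall i, measurable (A i) /\ measurable (B i)) ->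
         P (\bigcap_(i in `I_n) (X i @^-1` A i `&` e i @^-1` B i))
         = (\prod_(i < n) (P (X i @^-1` A i) * P (e i @^-1` B i)))%E)].

(* Main.v *)
(** Write g for the estimation error and D g for the difference between the
    empirical and the population version of the covariance operator
    g |-> E[g(X) K_X].  The first-order condition of the penalized likelihood
    says exactly that the Bahadur remainder is - D g, so everything reduces to
    the operator norm of D.  No chaining is needed: the second summand of A(h)
    alone gives A(h) >= 80, and this constant leaves room to bound D in
    Hilbert-Schmidt norm, by a Pinelis inequality for sums of independent
    vectors of norm at most sqrt 2 c_K^2 / h.  The noise term is treated by the
    same argument, with Gaussian coefficients in place of boundedness.

    In the eigenbasis provided by Assumption A1 both vectors are limits of
    finite-dimensional truncations, and the exceptional events of the
    truncations increase with the dimension.  When M n h r^2 < ln 2 the bound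
    exceeds 1 and there is nothing to prove. *)

Require Import Defs.
From HB Require Import structures.
From mathcomp Require Import all_boot all_order all_algebra.
From mathcomp Require Import all_classical all_reals all_analysis.
From mathcomp Require Import normal_distribution uniform_distribution.
From mathcomp Require Import measurable_realfun.
From mathcomp Require Import ring lra.

Set Implicit Arguments.
Unset Strict Implicit.
Unset Printing Implicit Defensive.

Import Order.TTheory GRing.Theory Num.Theory.
Import numFieldNormedType.Exports.

Local Open Scope classical_set_scope.
Local Open Scope ring_scope.

(** * Hyperbolic functions *)

(** Pinelis' argument follows [ch (nrm S)] for a partial sum [S]. Since cosh of a square root is
    convex, adding a vector at any angle interpolates between the two collinear cases, where the
    addition formulas for cosh apply. One summand thus costs a constant factor that does not see the
    dimension, which is what lets the truncations grow. The Chernoff bound carries a prefactor 2. It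
    is run with exponent [- 2 * u ^+ 2], where [u ^+ 2] is M n h r^2, and the prefactor is absorbed
    as soon as [ln 2 <= u ^+ 2]. Each of the two deviations, of D and of the noise, then costs
    [expR (- u ^+ 2)], and the 2 of the statement counts them. The exceptional event depends on the
    design and the noise only, not on f or on the estimator. Off it all estimates are deterministic,
    so the measurability of the estimator never matters and no preliminary consistency is needed:
    the remainder is at most a small multiple of the error, the error contains the remainder, and
    the small factor allows it to be absorbed. *)

Definition ch {R : realType} (y : R) : R := (expR y + expR (- y)) / 2.
Definition sh {R : realType} (y : R) : R := (expR y - expR (- y)) / 2.

Section Hyperbolic.
Context {R : realType}.
Implicit Types y p q b : R.

Lemma chD p q : ch (p + q) = ch p * ch q + sh p * sh q.
Proof.
by rewrite /ch /sh opprD !expRD; field.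
Qed.

Lemma chB p q : ch (p - q) = ch p * ch q - sh p * sh q.
Proof.
by rewrite /ch /sh opprB !expRD; field.
Qed.

Lemma ch_ge0 y : 0 <= ch y.
Proof. by rewrite /ch divr_ge0// addr_ge0// expR_ge0. Qed.

Lemma ch_ge1 y : 1 <= ch y.
Proof.
have h1 := expR_ge1Dx y; have h2 := expR_ge1Dx (- y).
rewrite /ch; lra.
Qed.

Lemma expR_le_ch y : expR y / 2 <= ch y.
Proof. have := expR_ge0 (- y); rewrite /ch; lra. Qed.

Lemma sh_le_ch y : sh y <= ch y.
Proof. have := expR_ge0 (- y); rewrite /ch /sh; lra. Qed.

Lemma sh0 : sh 0 = 0 :> R.
Proof. by rewrite /sh oppr0 subrr mul0r. Qed.

Lemma sh_ge0 y : 0 <= y -> 0 <= sh y.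
Proof.
move=> y0; rewrite /sh divr_ge0// subr_ge0 ler_expR; lra.
Qed.

(** Convexity of [t ^+ k] on the nonnegative half-line, with denominators cleared so that [a = b] is
    allowed. *)
Lemma pow_chord (a t b : R) k : 0 <= a -> a <= t -> t <= b ->
  (b - a) * t ^+ k <= (b - t) * a ^+ k + (t - a) * b ^+ k.
Proof.
move=> a0 at_ tb; elim: k => [|k IH]; first by rewrite !expr0; lra.
have t0 : 0 <= t by exact: le_trans at_.
have hab : a ^+ k <= b ^+ k.
  by rewrite lerXn2r ?nnegrE//; lra.
(* This product is exactly the gap between [t] times the chord for [k] and the chord for [k.+1]. *)
have h1 : 0 <= (b - t) * (t - a) * (b ^+ k - a ^+ k).
  by rewrite !mulr_ge0// subr_ge0.
have h2 : t * ((b - a) * t ^+ k) <= t * ((b - t) * a ^+ k + (t - a) * b ^+ k).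
  by rewrite ler_wpM2l.
rewrite !exprS; nra.
Qed.

Lemma ch_series y :
  series (fun k => exp_coeff y k + exp_coeff (- y) k) @ \oo --> 2 * ch y.
Proof.
rewrite /ch mulrC divfK ?pnatr_eq0//.
rewrite [X in X @ _ --> _](_ : _ = series (exp_coeff y) \+ series (exp_coeff (- y))).
  by apply: cvgD; exact: is_cvg_series_exp_coeff.
by apply/funext => n; rewrite /series /= big_split.
Qed.

Lemma exp_coeff_sym y k :
  exp_coeff y k + exp_coeff (- y) k =
  if odd k then 0 else 2 * (y ^+ 2) ^+ k./2 / k`!%:R.
Proof.
rewrite /exp_coeff /= exprNn -signr_odd.
have [ok|ek] := boolP (odd k); first by rewrite expr1 mulN1r mulNr subrr.
rewrite expr0 mul1r.
have -> : (y ^+ 2) ^+ k./2 = y ^+ k by rewrite -exprM mul2n even_halfK.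
by ring.
Qed.

(* The map [t |-> cosh (sqrt t)] is convex, being a power series with
   nonnegative coefficients; this is its chord inequality. *)
Lemma ch_chord (a t b : R) : 0 <= a -> a <= t -> t <= b ->
  (b ^+ 2 - a ^+ 2) * ch t <= (b ^+ 2 - t ^+ 2) * ch a + (t ^+ 2 - a ^+ 2) * ch b.
Proof.
move=> a0 at_ tb.
have t0 : 0 <= t by exact: le_trans at_.
have b0 : 0 <= b by exact: le_trans tb.
have sat : a ^+ 2 <= t ^+ 2 by rewrite lerXn2r ?nnegrE.
have stb : t ^+ 2 <= b ^+ 2 by rewrite lerXn2r ?nnegrE.
pose U y := series (fun k => exp_coeff y k + exp_coeff (- y) k).
have cU y : U y @ \oo --> 2 * ch y by exact: ch_series.
have : (b ^+ 2 - a ^+ 2) * (2 * ch t) <=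
    (b ^+ 2 - t ^+ 2) * (2 * ch a) + (t ^+ 2 - a ^+ 2) * (2 * ch b).
  have L : (fun n => (b ^+ 2 - a ^+ 2) * U t n) @ \oo -->
      (b ^+ 2 - a ^+ 2) * (2 * ch t) by apply: cvgMl_tmp; exact: cU.
  have Rr : (fun n => (b ^+ 2 - t ^+ 2) * U a n + (t ^+ 2 - a ^+ 2) * U b n) @ \oo -->
      (b ^+ 2 - t ^+ 2) * (2 * ch a) + (t ^+ 2 - a ^+ 2) * (2 * ch b).
    by apply: cvgD; apply: cvgMl_tmp; exact: cU.
  apply: ler_cvg_to L Rr _; near=> n.
  rewrite /U /series /= !mulr_sumr -big_split /=; apply: ler_sum => k _.
  rewrite !exp_coeff_sym; case: ifP => _; first by rewrite !mulr0 addr0.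
  have := @pow_chord (a ^+ 2) (t ^+ 2) (b ^+ 2) k./2 (sqr_ge0 _) sat stb.
  have : 0 <= 2 / k`!%:R :> R by rewrite divr_ge0.
  set c := 2 / _ => c0 hp.
  have := ler_wpM2l c0 hp.
  set ta := (t ^+ 2) ^+ _; set aa := (a ^+ 2) ^+ _; set bb := (b ^+ 2) ^+ _.
  by rewrite /c; set f := (_ `!%:R)^-1; nra.
lra.
Unshelve. all: by end_near. Qed.

(** By the law of cosines [y ^+ 2] moves linearly in [b] from [(p - q) ^+ 2] to [(p + q) ^+ 2]. The
    chord inequality with these two endpoints, expanded by [chB] and [chD], is the claim; the factor
    [p * q] is a quarter of the difference of the squares. *)
Lemma ch_triangle p q b y : 0 <= p -> 0 <= q -> `|b| <= p * q -> 0 <= y ->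
  y ^+ 2 = p ^+ 2 + q ^+ 2 + 2 * b ->
  (p * q) * ch y <= (p * q) * (ch p * ch q) + b * (sh p * sh q).
Proof.
move=> p0 q0; rewrite ler_norml => /andP[b1 b2] y0 yE.
wlog qp : p q p0 q0 b1 b2 yE / q <= p.
  move=> H; have [|/ltW pq] := leP q p; first exact: H.
  have := H q p q0 p0; rewrite ![q * p]mulrC ![ch q * _]mulrC ![sh q * _]mulrC.
  by apply => //; rewrite yE; ring.
have hB : ch (p - q) = ch p * ch q - sh p * sh q by exact: chB.
have hD : ch (p + q) = ch p * ch q + sh p * sh q by exact: chD.
have h1 : p - q <= y.
  rewrite -(@ler_pXn2r _ 2)// ?nnegrE ?subr_ge0// yE; nra.
have h2 : y <= p + q.
  rewrite -(@ler_pXn2r _ 2)// ?nnegrE ?addr_ge0// yE; nra.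
have := @ch_chord (p - q) y (p + q) _ h1 h2.
rewrite subr_ge0 => /(_ qp); rewrite yE hB hD.
set C := ch p * ch q; set S := sh p * sh q; set Y := ch y; nra.
Qed.

Lemma sh_ge_id y : 0 <= y -> y <= sh y.
Proof.
move=> y0.
have [->|yn0] := eqVneq y 0; first by rewrite sh0.
pose f (z : R) := sh z - z.
suff : f 0 <= f y by rewrite /f sh0 subr0 subr_ge0.
have df (z : R) : is_derive z (1:R) f (ch z - 1).
  rewrite /f /sh /ch.
  apply: is_derive_eq.
  by rewrite /GRing.scale/=; field.
have cf : continuous f.
  by move=> z; apply/differentiable_continuous/derivable1_diffP; exact: ex_derive.
have yp : 0 < y by rewrite lt_neqAle eq_sym yn0.
have [z _ hz] := @MVT R f (fun z => ch z - 1) 0 y yp (fun z _ => df z)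
   (continuous_subspaceT cf).
rewrite -subr_ge0 hz subr0 mulr_ge0// subr_ge0; exact: ch_ge1.
Qed.

(** [expR q - q] is what remains of one centered step once its linear term is removed. The constant
    2 is generous and allows an elementary proof: for [q <= 1], [expR q] is at most
    [(1 - q / 2) ^- 2], hence at most [1 + q + 2 * q ^+ 2]. *)
Lemma expR_sub_le q : 0 <= q -> expR q - q <= expR (2 * q ^+ 2).
Proof.
move=> q0; have [q1|q1] := leP q 1.
  have h1 := expR_ge1Dx (- (q / 2)).
  have h2 := expR_ge1Dx (2 * q ^+ 2).
  have h3 : expR (- (q / 2)) ^+ 2 * expR q = 1.
    by rewrite -expRM_natl -expRD -expR0; congr expR; field.
  have h4 : (1 - q / 2) ^+ 2 <= expR (- (q / 2)) ^+ 2.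
    by rewrite lerXn2r ?nnegrE//; lra.
  have e0 := expR_ge0 q.
  have h5 : (1 - q / 2) ^+ 2 * expR q <= 1.
    by apply: le_trans (ler_wpM2r e0 h4) _; rewrite h3.
  have h6 : 1 <= (1 - q / 2) ^+ 2 * (1 + q + 2 * q ^+ 2).
    have : 0 <= q ^+ 2 * ((1 - q) * (5 / 4 - q / 2)).
      by rewrite mulr_ge0 ?sqr_ge0// mulr_ge0; lra.
    nra.
  have h7 : 0 < (1 - q / 2) ^+ 2 by rewrite exprn_gt0//; lra.
  have : expR q <= 1 + q + 2 * q ^+ 2 by rewrite -(ler_pM2l h7) (le_trans h5).
  lra.
have : expR q <= expR (2 * q ^+ 2) by rewrite ler_expR; nra.
lra.
Qed.

End Hyperbolic.

(** * Euclidean vectors *)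

Definition dot {R : realType} {J : finType} (x y : J -> R) : R :=
  \sum_j x j * y j.
Definition nrm {R : realType} {J : finType} (x : J -> R) : R :=
  Num.sqrt (dot x x).

Lemma eq_ler {R : realType} (x y : R) : x = y -> x <= y.
Proof. by move=> ->. Qed.

Section EuclideanStep.
Context {R : realType} {J : finType}.
Implicit Types x y d a : J -> R.

Lemma dot_ge0 x : 0 <= dot x x.
Proof. by apply: sumr_ge0 => j _; rewrite -expr2 sqr_ge0. Qed.

Lemma nrm_ge0 x : 0 <= nrm x.
Proof. exact: sqrtr_ge0. Qed.

Lemma sqr_nrm x : nrm x ^+ 2 = dot x x.
Proof. by rewrite sqr_sqrtr// dot_ge0. Qed.

Lemma dotDD x y (a b : R) : dot (fun j => a * x j + b * y j) (fun j => a * x j + b * y j) =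
  a ^+ 2 * dot x x + 2 * a * b * dot x y + b ^+ 2 * dot y y.
Proof.
rewrite /dot !mulr_sumr -!big_split /=; apply: eq_bigr => j _; ring.
Qed.

(** Common source of the Cauchy-Schwarz inequalities for [dot], [Jf], [inner] and [Vf]. The forms
    may be degenerate, so [u = 0] is a case of its own. *)
Lemma quad_disc (u v w : R) : 0 <= u -> 0 <= v ->
  (forall a b : R, 0 <= a ^+ 2 * u + 2 * a * b * w + b ^+ 2 * v) -> w ^+ 2 <= u * v.
Proof.
move=> u0 v0 H.
have [u1|] := ltP 0 u.
  have := H w (- u); rewrite (_ : _ + _ = u * (u * v - w ^+ 2)); last by ring.
  by rewrite pmulr_rge0// subr_ge0.
move=> u1; have {u0 u1} uE : u = 0 by apply/eqP; rewrite eq_le u1.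
rewrite uE mul0r; have [->|w0] := eqVneq w 0; first by rewrite expr0n.
have := H (- (v + 1) / w) 1; rewrite uE (_ : _ + _ = - v - 2); last by field.
lra.
Qed.

Lemma dot_CS x y : `|dot x y| <= nrm x * nrm y.
Proof.
rewrite -(@ler_pXn2r _ 2)// ?nnegrE ?mulr_ge0 ?nrm_ge0// exprMn !sqr_nrm.
rewrite real_normK ?num_real//; apply: quad_disc; rewrite ?dot_ge0// => a b.
by rewrite -dotDD dot_ge0.
Qed.

Lemma sqr_nrmD x y : nrm (fun j => x j + y j) ^+ 2 =
  nrm x ^+ 2 + nrm y ^+ 2 + 2 * dot x y.
Proof.
rewrite !sqr_nrm; have := dotDD x y 1 1; under eq_fun do rewrite !mul1r.
by move=> ->; ring.
Qed.

Lemma nrmZ (s : R) x : nrm (fun j => s * x j) = `|s| * nrm x.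
Proof.
rewrite /nrm -sqrtr_sqr -sqrtrM ?sqr_ge0//; congr Num.sqrt.
by rewrite /dot mulr_sumr; apply: eq_bigr => j _; ring.
Qed.

(** [th] plays the cosine of the angle between two vectors of lengths [p] and [q]; this is
    [ch_triangle] after division by [p * q], extended to the degenerate case. *)
Lemma ch_cos (p q y th : R) : 0 <= p -> 0 <= q -> 0 <= y -> `|th| <= 1 ->
  y ^+ 2 = p ^+ 2 + q ^+ 2 + 2 * (p * q * th) ->
  ch y <= ch p * ch q + th * (sh p * sh q).
Proof.
move=> p0 q0 y0 th1 yE.
have [pq0|pq0] := eqVneq (p * q) 0.
  have ch0 : ch (0 : R) = 1 by rewrite /ch oppr0 expR0 divff.
  move: pq0 yE => /eqP; rewrite mulf_eq0 => /orP[/eqP->|/eqP->].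
    rewrite !mul0r expr0n/= mulr0 addr0 add0r => yE.
    have -> : y = q by apply/eqP; rewrite -(@eqrXn2 _ 2)// yE.
    by rewrite sh0 ch0 !mul0r mulr0 addr0 mul1r.
  rewrite !mulr0 mul0r expr0n/= mulr0 !addr0 => yE.
  have -> : y = p by apply/eqP; rewrite -(@eqrXn2 _ 2)// yE.
  by rewrite sh0 ch0 !mulr0 addr0 mulr1.
have pqp : 0 < p * q by rewrite lt_neqAle eq_sym pq0 mulr_ge0.
have hb : `|p * q * th| <= p * q.
  by rewrite normrM (ger0_norm (ltW pqp)) ler_piMr// ltW.
have := @ch_triangle _ p q (p * q * th) y p0 q0 hb y0 yE.
move=> H; rewrite -(ler_pM2l pqp); apply: (le_trans H).
by apply: eq_ler; ring.
Qed.

Lemma dot_cos x d : exists th : R, `|th| <= 1 /\ dot x d = nrm x * nrm d * th.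
Proof.
have := dot_CS x d; set p := nrm x * nrm d => H.
have p0 : 0 <= p by rewrite mulr_ge0 ?nrm_ge0.
have [pE|pn] := eqVneq p 0.
  exists 0; rewrite normr0 ler01 mulr0; split => //.
  by apply/eqP; rewrite -normr_le0 -pE.
have pp : 0 < p by rewrite lt_neqAle eq_sym pn.
exists (dot x d / p); split; last by rewrite mulrC divfK.
by rewrite normrM normfV (ger0_norm p0) ler_pdivrMr// mul1r.
Qed.

(* One step of Pinelis' argument: the last term integrates to zero when [d] is
   centered. *)
Lemma ch_nrm_centered x d c : nrm d <= c ->
  ch (nrm (fun j => x j + d j)) <=
  ch (nrm x) * expR (2 * c ^+ 2) + sh (nrm x) / nrm x * dot x d.
Proof.
move=> dc; have [th [th1 dE]] := dot_cos x d.
have p0 := nrm_ge0 x; have q0 := nrm_ge0 d.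
have h1 : ch (nrm (fun j => x j + d j)) <=
    ch (nrm x) * ch (nrm d) + th * (sh (nrm x) * sh (nrm d)).
  by apply: ch_cos; rewrite ?nrm_ge0// sqr_nrmD dE.
apply: (le_trans h1); rewrite dE.
set p := nrm x in p0 *; set q := nrm d in q0 dc *.
have -> : sh p / p * (p * q * th) = sh p * q * th.
  have [->|pn] := eqVneq p 0; first by rewrite sh0 !mul0r.
  by field.
(* Without the linear term the bound is [ch p * ch q + th * sh p * (sh q - q)]. From [th <= 1],
   [sh p <= ch p] and [q <= sh q] it is at most [ch p * (expR q - q)]. *)
have e1 : expR q - q <= expR (2 * c ^+ 2).
  apply: (le_trans (expR_sub_le q0)); rewrite ler_expR ler_pM2l//.
  by rewrite lerXn2r// nnegrE (le_trans q0).
have e2 : expR q = ch q + sh q by rewrite /ch /sh; field.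
have e3 := ch_ge0 p; have e4 := sh_le_ch p; have e5 := sh_ge0 p0.
have e6 := sh_ge_id q0; move: th1; rewrite ler_norml => /andP[t1 t2].
have : ch p * (ch q + sh q - q) <= ch p * expR (2 * c ^+ 2).
  by rewrite ler_wpM2l// -e2.
have : 0 <= sh p * (sh q - q) * (1 - th).
  by apply: mulr_ge0; [apply: mulr_ge0|]; rewrite ?subr_ge0.
have : 0 <= (ch p - sh p) * (sh q - q) by apply: mulr_ge0; rewrite subr_ge0.
set A := expR _; nra.
Qed.

(** Along a line the bound of [ch_cos] is a nonnegative combination of two exponentials in [z]. Both
    have the same standard Gaussian mean, so unbounded Gaussian coefficients can be integrated
    although no bound on the increment is available. *)
Lemma ch_nrm_line x a : exists c1 c2 : R,
  [/\ 0 <= c1, 0 <= c2, c1 + c2 = ch (nrm x) &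
  forall z : R, ch (nrm (fun j => x j + z * a j)) <=
    c1 * expR (nrm a * z) + c2 * expR (- nrm a * z)].
Proof.
have [th [th1 dE]] := dot_cos x a.
have p0 := nrm_ge0 x; have q0 := nrm_ge0 a.
have e4 := sh_le_ch (nrm x); have e5 := sh_ge0 p0.
have := th1; rewrite ler_norml => /andP[t1 t2].
exists ((ch (nrm x) + th * sh (nrm x)) / 2), ((ch (nrm x) - th * sh (nrm x)) / 2).
split; [nra|nra|by field|move=> z].
(* The sign of [z] moves into the cosine because the norm of the increment only sees [|z|]. *)
have dz : dot x (fun j => z * a j) = nrm x * nrm (fun j => z * a j) * (Num.sg z * th).
  rewrite nrmZ (_ : dot _ _ = z * dot x a).
    by rewrite dE [in LHS](numEsg z); ring.
  by rewrite /dot mulr_sumr; apply: eq_bigr => j _; ring.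
have h1 : ch (nrm (fun j => x j + z * a j)) <=
    ch (nrm x) * ch (nrm (fun j => z * a j)) +
    Num.sg z * th * (sh (nrm x) * sh (nrm (fun j => z * a j))).
  apply: ch_cos; rewrite ?nrm_ge0// ?sqr_nrmD ?dz//.
  by rewrite normrM -[leRHS]mulr1 ler_pM// normr_sg lern1 leq_b1.
apply: (le_trans h1); rewrite nrmZ.
have [zp|zn|->] := ltrgt0P z.
- rewrite gtr0_sg// (mulrC z) mulNr /ch /sh.
  by apply: eq_ler; field.
- rewrite ltr0_sg// (_ : - z * nrm a = - (nrm a * z)); last by ring.
  rewrite !mulNr /ch /sh opprK.
  by apply: eq_ler; field.
- rewrite sgr0 !mul0r !mulr0 addr0 expR0 /ch oppr0 expR0.
  by apply: eq_ler; field.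
Qed.

End EuclideanStep.

(** * Independence and Fubini *)

Section IndependentStep.
Context {R : realType} {d : measure_display} {T : measurableType d}.
Variables (P : probability T R) (G : set (set T)) (Z : T -> measurableTypeR R).
Variable (q : probability (measurableTypeR R) R).
Hypothesis GI : setI_closed G.
Hypothesis GT : G setT.
Hypothesis Gm : G `<=` measurable.
Hypothesis mZ : measurable_fun setT Z.
Hypothesis PZ : forall A B, G A -> measurable B ->
  P (A `&` Z @^-1` B) = (P A * q B)%E.

Local Notation T' := (g_sigma_algebraType G).

Lemma measurable_sub_sigma (A : set T) : <<s G >> A -> measurable A.
Proof.
by apply: smallest_sub => //; exact: sigma_algebra_measurable.
Qed.

Let idm : T -> T' := id.

Let midm : measurable_fun setT idm.
Proof.
by move=> _ A mA; rewrite setTI; exact: measurable_sub_sigma.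
Qed.

Let mPZ (B : set (measurableTypeR R)) : measurable B -> measurable (Z @^-1` B).
Proof. by move=> mB; rewrite -[X in measurable X]setTI; exact: mZ. Qed.

(** For fixed [B] both sides are finite measures in [A] that agree on the pi-system [G], which
    contains the whole space; they agree on the generated sigma-algebra. *)
Lemma indep_sigma A B : <<s G >> A -> measurable B ->
  P (A `&` Z @^-1` B) = (P A * q B)%E.
Proof.
move=> sA mB.
have r0 : (0 <= fine (q B))%R by rewrite fine_ge0.
have qE : q B = (fine (q B))%:E by rewrite fineK// fin_num_measure.
pose m1 := mrestr P (mPZ mB).
pose m2 := mscale (NngNum r0) P.
have -> : (P A * q B = m2 A)%E by rewrite /m2 /mscale /= -qE muleC.
have -> : P (A `&` Z @^-1` B) = m1 A by [].
apply: (@g_sigma_algebra_measure_unique _ _ _ G Gm (fun=> setT)) => //.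
- by rewrite bigcup_const.
- move=> C GC; change (P (C `&` Z @^-1` B) = (fine (q B))%:E * P C)%E; rewrite (PZ GC mB) -qE muleC; reflexivity.
- move=> k; change (P (setT `&` Z @^-1` B) < +oo)%E.
  by rewrite setTI (le_lt_trans (probability_le1 _ _)) ?ltry//; exact: mPZ.
Qed.

Let joint (w : T) : (T' * measurableTypeR R)%type := (idm w, Z w).

Let mjoint : measurable_fun setT joint.
Proof. exact: measurable_fun_pair. Qed.


(** The identity as a map to the coarser measurable space [T']: its distribution is [P] restricted
    to the sigma-algebra of [G], the first factor of the product law of [joint]. *)
Let X1 : {mfun T >-> T'} := HB.pack idm (isMeasurableFun.Build _ _ _ _ idm midm).
Let X2 : {mfun T >-> (T' * measurableTypeR R)%type} :=
  HB.pack joint (isMeasurableFun.Build _ _ _ _ joint mjoint).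

(** Freezing lemma: the pair of the past and [Z] has a product law, so Tonelli allows [Z] to be
    integrated first. Joint measurability is over [T'], that is, [f] may use the first argument only
    through the past. *)
Lemma indep_integral (f : T -> R -> \bar R) :
  measurable_fun setT ((fun z => f z.1 z.2) : T' * measurableTypeR R -> \bar R) ->
  (forall w z, 0 <= f w z)%E ->
  (\int[P]_w f w (Z w) = \int[P]_w \int[q]_z f w z)%E.
Proof.
move=> mf f0; pose g (z : T' * measurableTypeR R) := f z.1 z.2.
transitivity (\int[distribution P X2]_z g z)%E.
  by rewrite ge0_integral_distribution// => z; exact: f0.
transitivity (\int[distribution P X1 \x q]_z g z)%E.
  apply: eq_measure_integral => /= A mA _; symmetry.
  apply: product_measure_unique => // A1 A2 mA1 mA2.
  by rewrite /distribution /pushforward /= -indep_sigma.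
rewrite fubini_tonelli1//=; last by move=> z; exact: f0.
rewrite ge0_integral_distribution//=.
- by apply: measurable_fun_fubini_tonelli_F => // z; exact: f0.
- by move=> w; apply: integral_ge0 => z _; exact: f0.
Qed.

Lemma indep_inner_measurable (f : T -> R -> \bar R) :
  measurable_fun setT ((fun z => f z.1 z.2) : T' * measurableTypeR R -> \bar R) ->
  (forall w z, 0 <= f w z)%E ->
  measurable_fun setT (fun w => \int[q]_z f w z)%E.
Proof.
move=> mf f0.
have mF : measurable_fun setT ((fun w => \int[q]_z f w z)%E : T' -> \bar R).
  pose g (z : T' * measurableTypeR R) := f z.1 z.2.
  have : measurable_fun setT (fubini_F q g).
    by apply: measurable_fun_fubini_tonelli_F => // z; exact: f0.
  by [].
by move=> _ B mB; apply: measurable_sub_sigma; exact: mF.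
Qed.

End IndependentStep.

(** * Gaussian moment generating function *)

Section Density.
Context {R : realType}.
Local Notation mu := (@lebesgue_measure R).
Variables (nu : {measure set (measurableTypeR R) -> \bar R}) (p : R -> R).
Hypothesis mp : measurable_fun setT p.
Hypothesis p0 : forall x, 0 <= p x.
Hypothesis nuE : forall A, measurable A -> nu A = (\int[mu]_(x in A) (p x)%:E)%E.

Import HBNNSimple.

(** The density is known through measures of sets; simple functions and monotone convergence carry
    it to integrals. *)
Lemma integral_density (f : measurableTypeR R -> R) :
  measurable_fun setT f -> (forall x, 0 <= f x) ->
  (\int[nu]_x (f x)%:E = \int[mu]_x (f x * p x)%:E)%E.
Proof.
move=> mf f0.
have mfE : measurable_fun setT (EFin \o f) by exact/measurable_EFinP.
have simple (g : {nnsfun (measurableTypeR R) >-> R}) :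
    (\int[nu]_x (g x)%:E = \int[mu]_x (g x * p x)%:E)%E.
  under [LHS]eq_integral do rewrite fimfunE -fsumEFin//.
  rewrite [LHS]ge0_integral_fsum//; last 2 first.
    - by move=> r; exact/measurable_EFinP/measurableT_comp.
    - by move=> n x _; rewrite EFinM nnfun_muleindic_ge0.
  under [RHS]eq_integral.
    move=> x _; rewrite fimfunE EFinM -fsumEFin// ge0_mule_fsuml; last first.
      by move=> r; rewrite EFinM nnfun_muleindic_ge0.
    over.
  rewrite [RHS]ge0_integral_fsum//; last 2 first.
    - move=> r; apply/measurable_EFinP; apply: measurable_funM => //.
      by apply: measurable_funM => //; exact: measurable_indic.
    - by move=> n x _; rewrite mule_ge0// ?lee_fin//; rewrite -lee_fin EFinM nnfun_muleindic_ge0.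
  apply: eq_fsbigr => r rg.
  have [r0|r0] := ltP r 0.
    rewrite !integral0_eq// => x _; rewrite preimage_nnfun0// indic0 mulr0 ?mul0e//.
  have mA : measurable (g @^-1` [set r]) by [].
  under eq_integral do rewrite EFinM.
  rewrite ge0_integralZl//; last by apply/measurable_EFinP; exact: measurable_indic.
  rewrite integral_indic// setIT.
  under [RHS]eq_integral do rewrite EFinM -muleA.
  rewrite ge0_integralZl//; last 2 first.
    - apply/measurable_EFinP; apply: measurable_funM => //; exact: measurable_indic.
    - by move=> x _; rewrite mule_ge0// lee_fin.
  congr (_ * _)%E; rewrite nuE// [LHS]integral_mkcond; apply: eq_integral => x _.
  by rewrite patchE indicE; case: ifPn => _; rewrite ?mul1e ?mul0e.
pose f_ := nnsfun_approx measurableT mfE.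
have cf x : (f_ n x)%:E @[n --> \oo] --> (f x)%:E.
  by apply: (@cvg_nnsfun_approx _ _ _ _ measurableT (EFin \o f)) => // y _; rewrite lee_fin.
transitivity (lim (\int[nu]_x (f_ n x)%:E @[n --> \oo])%E).
  rewrite -monotone_convergence//=.
  - by apply: eq_integral => x _; apply/esym/cvg_lim.
  - by move=> n; exact/measurable_EFinP/measurable_funTS.
  - by move=> n x _; rewrite lee_fin.
  - by move=> x _ a b ab; rewrite lee_fin; exact/lefP/nd_nnsfun_approx.
under eq_fun do rewrite simple.
rewrite -monotone_convergence//=.
- apply: eq_integral => x _; apply/cvg_lim => //.
  under eq_fun do rewrite EFinM muleC.
  rewrite EFinM muleC; apply: cvgeZl => //; exact: cf.
- move=> n; apply/measurable_EFinP; apply: measurable_funM => //.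
- by move=> n x _; rewrite lee_fin mulr_ge0.
- move=> x _ a b ab; rewrite lee_fin ler_wpM2r//; exact/lefP/nd_nnsfun_approx.
Qed.

End Density.

Lemma normal_mgf {R : realType} (t : R) :
  (\int[normal_prob 0 1]_z (expR (t * z))%:E = (expR (t ^+ 2 / 2))%:E :> \bar R)%E.
Proof.
have mt : measurable_fun setT (fun z : measurableTypeR R => expR (t * z)).
  by apply: measurableT_comp => //; apply: measurable_funM.
rewrite (@integral_density _ (normal_prob 0 1) (normal_pdf 0 1)
  (measurable_normal_pdf 0 1) (normal_pdf_ge0 0 1) (fun A _ => erefl) _ mt)//.
(* Completing the square: the tilted standard density is a constant times the normal density
   centered at [t]. *)
have E x : expR (t * x) * normal_pdf 0 1 x = expR (t ^+ 2 / 2) * normal_pdf t 1 x.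
  rewrite /normal_pdf !oner_eq0 /normal_fun mulrCA [RHS]mulrCA -!expRD.
  by congr (_ * expR _); field.
under eq_integral do rewrite E EFinM.
rewrite ge0_integralZl//=; last 2 first.
- by apply/measurable_EFinP; exact: measurable_normal_pdf.
- by move=> x _; rewrite lee_fin normal_pdf_ge0.
by rewrite integral_normal_pdf mule1.
Qed.

Lemma measurable_ch_nrm {R : realType} {J : finType} {d} {T : measurableType d}
  (F : J -> T -> R) : (forall j, measurable_fun setT (F j)) ->
  measurable_fun setT (fun w => ch (nrm (fun j => F j w))).
Proof.
move=> mF; have mch : measurable_fun setT (fun w => nrm (fun j => F j w)).
  apply: (@measurableT_comp _ _ _ _ _ _ (@Num.sqrt R)).
    by apply: continuous_measurable_fun; exact: sqrt_continuous.
  by apply: measurable_sum => j; apply: measurable_funM.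
rewrite /ch; apply: measurable_funM => //.
by apply: measurable_funD; apply: measurableT_comp => //; apply: measurableT_comp.
Qed.

Lemma coordinate_integrable {R : realType} {J : finType}
  (q : probability (measurableTypeR R) R) (v : J -> measurableTypeR R -> R) (c : R) l :
  (forall l, measurable_fun setT (v l)) -> (forall z, nrm (v ^~ z) <= c) ->
  q.-integrable setT (fun z => (v l z)%:E).
Proof.
move=> mv vc; apply: measurable_bounded_integrable => //.
  by rewrite -ge0_fin_numE// fin_num_measure.
exists c; split; rewrite ?num_real// => M cM z _ /=.
apply: le_trans (ltW cM); apply: le_trans (vc z).
rewrite -(@ler_pXn2r _ 2)// ?nnegrE ?nrm_ge0// sqr_nrm real_normK ?num_real//.
rewrite /dot (bigD1 l)//= -expr2 lerDl sumr_ge0// => i _.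
by rewrite -expr2 sqr_ge0.
Qed.

(** * The past of an independent sequence *)

Section Past.
Context {R : realType} {d : measure_display} {T : measurableType d}.
Variables (P : probability T R) (Z : nat -> T -> R) (N : nat).
Hypothesis mZ : forall j, measurable_fun setT (Z j).
Hypothesis indZ : forall B : nat -> set R, (forall j, measurable (B j)) ->
  P (\bigcap_(j in `I_N) Z j @^-1` B j) = (\prod_(j < N) P (Z j @^-1` B j))%E.

(** Finite cylinders over the first [k] variables: only a pi-system, on which independence is a
    product formula. Its generated sigma-algebra is the information available at time [k]. *)
Definition past (k : nat) : set (set T) := [set A | exists B : nat -> set R,
  (forall j, measurable (B j)) /\ A = \bigcap_(j in `I_k) Z j @^-1` B j].

Let mpre j (B : set R) : measurable B -> measurable (Z j @^-1` B).
Proof. by move=> mB; rewrite -[X in measurable X]setTI; exact: mZ. Qed.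

Lemma past_setI k : setI_closed (past k).
Proof.
move=> _ _ [A [mA ->]] [B [mB ->]]; exists (fun j => A j `&` B j); split.
  by move=> j; exact: measurableI.
by rewrite -bigcapI; apply: eq_bigcapr => j _; rewrite preimage_setI.
Qed.

Lemma past_setT k : past k setT.
Proof.
exists (fun=> setT); split => //.
by apply/esym/seteqP; split => // w _ j _.
Qed.

Lemma past_measurable_set k : past k `<=` measurable.
Proof.
move=> _ [B [mB ->]]; apply: bigcap_measurableType => j _; exact: mpre.
Qed.

Lemma past_measurable k j : (j < k)%N ->
  measurable_fun setT (Z j : g_sigma_algebraType (past k) -> R).
Proof.
move=> jk _ B mB; rewrite setTI; apply: sub_sigma_algebra.
exists (fun i => if i == j then B else setT); split.
  by move=> i; case: ifP.
apply/seteqP; split => [w Bw i _ /=|w /(_ j jk)/=]; last by rewrite eqxx.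
by case: eqVneq => // ->.
Qed.

Lemma past_prod k B : (k <= N)%N -> (forall j, measurable (B j)) ->
  P (\bigcap_(j in `I_k) Z j @^-1` B j) = (\prod_(j < k) P (Z j @^-1` B j))%E.
Proof.
move=> kN mB; pose B' j := if (j < k)%N then B j else setT.
have -> : \bigcap_(j in `I_k) Z j @^-1` B j = \bigcap_(j in `I_N) Z j @^-1` B' j.
  apply/seteqP; split => [w Bw j _ /=|w Bw j jk].
    by rewrite /B'; case: ifP => // jk; exact: Bw.
  by have := Bw j (leq_trans jk kN); rewrite /= /B' jk.
rewrite indZ; last by move=> j; rewrite /B'; case: ifP.
rewrite (bigID (fun j : 'I_N => (j < k)%N))/= [X in (_ * X)%E]big1 ?mule1; last first.
  by move=> j /negbTE jk; rewrite /B' jk preimage_setT probability_setT.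
rewrite (big_ord_widen N (fun j => P (Z j @^-1` B j)))//.
by apply: eq_bigr => j jk; rewrite /B' jk.
Qed.

Lemma past_indep k A B : (k < N)%N -> past k A -> measurable B ->
  P (A `&` Z k @^-1` B) = (P A * P (Z k @^-1` B))%E.
Proof.
move=> kN [C [mC ->]] mB; pose D j := if j == k then B else C j.
have mD j : measurable (D j) by rewrite /D; case: ifP.
have -> : \bigcap_(j in `I_k) Z j @^-1` C j `&` Z k @^-1` B =
    \bigcap_(j in `I_k.+1) Z j @^-1` D j.
  apply/seteqP; split => [w [Cw Bw] j /= jk|w Dw].
    rewrite /D; case: eqVneq => [->//|jnk]; apply: Cw => /=.
    by rewrite ltn_neqAle jnk.
  split; last by have := Dw k (ltnSn k); rewrite /= /D eqxx.
  move=> j jk; have := Dw j (ltnW jk : (j < k.+1)%N).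
  by rewrite /= /D ltn_eqF.
rewrite !past_prod//; last exact: ltnW.
rewrite big_ord_recr /= {2}/D eqxx; congr (_ * _)%E.
by apply: eq_bigr => j _; rewrite /D ltn_eqF.
Qed.

Variables (k : nat) (q : probability (measurableTypeR R) R).
Hypothesis kN : (k < N)%N.
Hypothesis lawZ : forall B, measurable B -> P (Z k @^-1` B) = q B.
Local Notation T' := (g_sigma_algebraType (past k)).

Lemma past_integral (f : T -> R -> \bar R) :
  measurable_fun setT ((fun z => f z.1 z.2) : T' * measurableTypeR R -> \bar R) ->
  (forall w z, 0 <= f w z)%E ->
  (\int[P]_w f w (Z k w) = \int[P]_w \int[q]_z f w z)%E.
Proof.
apply: indep_integral.
- exact: past_setI.
- exact: past_setT.
- exact: past_measurable_set.
- exact: mZ.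
- by move=> A B pA mB; rewrite past_indep// lawZ.
Qed.

Lemma past_inner_measurable (f : T -> R -> \bar R) :
  measurable_fun setT ((fun z => f z.1 z.2) : T' * measurableTypeR R -> \bar R) ->
  (forall w z, 0 <= f w z)%E ->
  measurable_fun setT (fun w => \int[q]_z f w z)%E.
Proof. by apply: indep_inner_measurable; exact: past_measurable_set. Qed.

Lemma past_measurableW (S : T -> R) :
  measurable_fun setT (S : T' -> R) -> measurable_fun setT S.
Proof.
move=> mS _ B mB; apply: measurable_sub_sigma; first exact: past_measurable_set.
exact: mS.
Qed.

Variable J : finType.

Lemma centered_step (S : J -> T -> R) (v : J -> measurableTypeR R -> R) (c : R) :
  (forall l, measurable_fun setT (S l : T' -> R)) ->
  (forall l, measurable_fun setT (v l)) ->
  (forall z, nrm (v ^~ z) <= c) ->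
  (forall l, \int[q]_z (v l z)%:E = 0)%E ->
  (\int[P]_w (ch (nrm (fun l => S l w + v l (Z k w))))%:E <=
   (expR (2 * c ^+ 2))%:E * \int[P]_w (ch (nrm (S ^~ w)))%:E)%E.
Proof.
move=> mS mv vc v0.
pose f w z := (ch (nrm (fun l => S l w + v l z)))%:E.
have mf : measurable_fun setT ((fun z => f z.1 z.2) : T' * measurableTypeR R -> \bar R).
  apply/measurable_EFinP.
  apply: (@measurable_ch_nrm _ _ _ (T' * measurableTypeR R)%type (fun l z => S l z.1 + v l z.2)).
  by move=> l; apply: measurable_funD; [exact: (measurableT_comp (mS l))|exact: (measurableT_comp (mv l))].
have f0 w z : (0 <= f w z)%E by rewrite lee_fin ch_ge0.
rewrite (past_integral mf f0).
have c0 : 0 <= c := le_trans (nrm_ge0 _) (vc point).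
have mS' l : measurable_fun setT (S l) by exact: past_measurableW.
rewrite -ge0_integralZl//=; last 2 first.
- by apply/measurable_EFinP; exact: measurable_ch_nrm.
- by move=> w _; rewrite lee_fin ch_ge0.
have iv l : q.-integrable setT (fun z => (v l z)%:E) by exact: coordinate_integrable mv vc.
apply: ge0_le_integral => //.
- by move=> w _; apply: integral_ge0 => z _; rewrite lee_fin ch_ge0.
- exact: (past_inner_measurable mf f0).
- by apply: measurable_funeM; apply/measurable_EFinP; exact: measurable_ch_nrm.
move=> w _.
pose C := ch (nrm (S ^~ w)) * expR (2 * c ^+ 2).
(* Coefficient of the linear term in [ch_nrm_centered]. It depends on the past [w] alone, so this
   term integrates to zero in [z]. *)
pose g l := sh (nrm (S ^~ w)) / nrm (S ^~ w) * S l w.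
apply: (@le_trans _ _ (\int[q]_z (C%:E + \sum_l (g l)%:E * (v l z)%:E))%E).
  apply: ge0_le_integral => //.
  - apply/measurable_EFinP; apply: (@measurable_ch_nrm _ _ _ _ (fun l z => S l w + v l z)).
    by move=> l; apply: measurable_funD.
  - apply: emeasurable_funD => //; apply: emeasurable_sum => l.
    by apply: measurable_funeM; apply/measurable_EFinP.
  - move=> z _; under eq_bigr do rewrite -EFinM.
    rewrite sumEFin -EFinD lee_fin; apply: (le_trans (ch_nrm_centered _ (vc z))).
    rewrite lerD2l /dot mulr_sumr; apply: ler_sum => l _.
    by rewrite /g mulrA.
rewrite integralD//=; last 2 first.
- exact: finite_measure_integrable_cst.
- by apply: integrable_sum => // l _; apply: integrableZl.
rewrite integral_cst//.
rewrite [X in (X + _)%E](_ : _ = C%:E); last first.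
  by rewrite -[RHS]mule1; congr (_ * _)%E; exact: (@probability_setT _ _ _ q).
rewrite integral_sum//; last first.
  by move=> l; apply: integrableZl.
rewrite big1 ?adde0; first by rewrite /C EFinM muleC.
by move=> l _; rewrite integralZl// v0 mule0.
Qed.

(** Given the past the increment is Gaussian on a fixed line, even though the direction [a] is
    random. The two exponentials of [ch_nrm_line] have equal Gaussian means, and their weights add
    up to [ch (nrm S)]. *)
Lemma gaussian_step (S a : J -> T -> R) (c : R) :
  (forall B, measurable B -> q B = normal_prob 0 1 B) ->
  (forall l, measurable_fun setT (S l : T' -> R)) ->
  (forall l, measurable_fun setT (a l : T' -> R)) ->
  (forall w, nrm (a ^~ w) <= c) ->
  (\int[P]_w (ch (nrm (fun l => S l w + Z k w * a l w)))%:E <=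
   (expR (c ^+ 2 / 2))%:E * \int[P]_w (ch (nrm (S ^~ w)))%:E)%E.
Proof.
move=> qN mS ma ac.
pose f w z := (ch (nrm (fun l => S l w + z * a l w)))%:E.
have mf : measurable_fun setT ((fun z => f z.1 z.2) : T' * measurableTypeR R -> \bar R).
  apply/measurable_EFinP.
  apply: (@measurable_ch_nrm _ _ _ (T' * measurableTypeR R)%type
    (fun l z => S l z.1 + z.2 * a l z.1)).
  move=> l; apply: measurable_funD; first exact: (measurableT_comp (mS l)).
  by apply: measurable_funM; [exact: measurable_snd|exact: (measurableT_comp (ma l))].
have f0 w z : (0 <= f w z)%E by rewrite lee_fin ch_ge0.
rewrite (past_integral mf f0).
have mS' l : measurable_fun setT (S l) by exact: past_measurableW.
rewrite -ge0_integralZl//=; last 2 first.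
- by apply/measurable_EFinP; exact: measurable_ch_nrm.
- by move=> w _; rewrite lee_fin ch_ge0.
apply: ge0_le_integral => //.
- by move=> w _; apply: integral_ge0 => z _; rewrite lee_fin ch_ge0.
- exact: (past_inner_measurable mf f0).
- by apply: measurable_funeM; apply/measurable_EFinP; exact: measurable_ch_nrm.
move=> w _.
have [c1 [c2 [c10 c20 cE H]]] := ch_nrm_line (S ^~ w) (a ^~ w).
set al := nrm (a ^~ w) in H *.
have mexp (t : R) : measurable_fun setT (fun z : measurableTypeR R => (expR (t * z))%:E).
  apply/measurable_EFinP.
  by apply: measurableT_comp => //; apply: measurable_funM.
apply: (@le_trans _ _ (\int[normal_prob 0 1]_z
    (c1%:E * (expR (al * z))%:E + c2%:E * (expR (- al * z))%:E))%E).
  rewrite (eq_measure_integral (normal_prob 0 1)); last by move=> A mA _; exact: qN.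
  apply: ge0_le_integral => //.
  - apply/measurable_EFinP; apply: (@measurable_ch_nrm _ _ _ (measurableTypeR R) (fun l z => S l w + z * a l w)).
    by move=> l; apply: measurable_funD => //; apply: measurable_funM.
  - by apply: emeasurable_funD; apply: measurable_funeM.
  - by move=> z _; rewrite -!EFinM -EFinD lee_fin; exact: H.
have ex0 (t z : R) : (0 <= (expR (t * z))%:E)%E by rewrite lee_fin expR_ge0.
rewrite ge0_integralD//=; last 4 first.
- by move=> z _; rewrite mule_ge0// lee_fin.
- exact: measurable_funeM.
- by move=> z _; rewrite mule_ge0// lee_fin.
- exact: measurable_funeM.
rewrite !ge0_integralZl// !normal_mgf sqrrN -!EFinM -EFinD lee_fin -mulrDl cE.
rewrite mulrC ler_wpM2r ?ch_ge0// ler_expR ler_pM2r//.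
have c0 : 0 <= c := le_trans (nrm_ge0 _) (ac w).
by rewrite lerXn2r ?nnegrE ?nrm_ge0//; exact: ac.
Qed.

End Past.

(** * Concentration of sums *)

Lemma two_expR_le {R : realType} (u : R) : ln 2 <= u ^+ 2 ->
  2 * expR (- (2 * u ^+ 2)) <= expR (- u ^+ 2).
Proof.
move=> u2.
have -> : - (2 * u ^+ 2) = - u ^+ 2 + - u ^+ 2 by ring.
rewrite expRD mulrA ler_piMl ?expR_ge0// expRN ler_pdivrMr ?expR_gt0// mul1r.
by rewrite -[leLHS]lnK ?posrE// ler_expR.
Qed.

(** Chernoff's bound with cosh in place of the exponential, [expR y / 2 <= ch y] being the source of
    a prefactor 2. *)
Lemma tail_of_mgf {R : realType} {d} {T : measurableType d} (P : probability T R)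
  (J : finType) (F : J -> T -> R) (B u : R) :
  (forall j, measurable_fun setT (F j)) -> 0 < B -> 0 <= u -> ln 2 <= u ^+ 2 ->
  (forall s, 0 <= s ->
    (\int[P]_w (ch (nrm (fun j => s * F j w)))%:E <= (expR (B * s ^+ 2))%:E)%E) ->
  let A := [set w | 8 * B * u ^+ 2 < dot (F ^~ w) (F ^~ w)] in
  measurable A /\ (P A <= (expR (- u ^+ 2))%:E)%E.
Proof.
move=> mF B0 u0 u2 H A.
have mA : measurable A.
  rewrite (_ : A = (fun w => dot (F ^~ w) (F ^~ w)) @^-1` `]8 * B * u ^+ 2, +oo[).
    rewrite -[X in measurable X]setTI.
    have : measurable_fun setT (fun w => dot (F ^~ w) (F ^~ w)).
      by apply: measurable_sum => j; apply: measurable_funM.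
    by apply => //; exact: measurable_itv.
  by apply/seteqP; split => w; rewrite /A /= in_itv /= andbT.
split => //.
pose t := Num.sqrt (8 * B) * u.
have t0 : 0 <= t by rewrite mulr_ge0// sqrtr_ge0.
have t2 : t ^+ 2 = 8 * B * u ^+ 2 by rewrite exprMn sqr_sqrtr// mulr_ge0// ltW.
(* This [s] maximizes [s * t - B * s ^+ 2] and leaves [2 * expR (- (2 * u ^+ 2))]. The threshold
   [8 * B * u ^+ 2] is twice what the exponent [- u ^+ 2] requires; the surplus absorbs the 2. *)
pose s := t / (2 * B).
have s0 : 0 <= s by rewrite divr_ge0// mulr_ge0// ltW.
have Bn : B != 0 by rewrite gt_eqF.
have st : s * t = 4 * u ^+ 2.
  rewrite /s mulrAC -expr2 t2; by field.
have Bs : B * s ^+ 2 = 2 * u ^+ 2.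
  rewrite /s expr_div_n t2; by field.
have c0 : 0 < expR (4 * u ^+ 2) / 2 :> R by rewrite divr_gt0// expR_gt0.
have mG : measurable_fun setT (fun w => ch (nrm (fun j => s * F j w))).
  by apply: measurable_ch_nrm => j; apply: measurable_funM.
have : ((expR (4 * u ^+ 2) / 2)%:E * P A <= (expR (2 * u ^+ 2))%:E)%E.
  rewrite -Bs; apply: le_trans (H s s0).
  have m1 : measurable_fun setT (fun w => (\1_A w)%:E : \bar R).
    by apply/measurable_EFinP; exact: measurable_indic.
  have c0E : (0 <= (expR (4 * u ^+ 2) / 2)%:E)%E by rewrite lee_fin ltW.
  have p1 w : setT w -> (0 <= (\1_A w)%:E :> \bar R)%E by rewrite lee_fin.
  have := @ge0_integralZl _ _ _ P setT measurableT (fun w => (\1_A w)%:E) m1 _ p1 c0E.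
  rewrite integral_indic// setIT => <-.
  apply: ge0_le_integral => //.
  - by apply: measurable_funeM; apply/measurable_EFinP; exact: measurable_indic.
  - exact/measurable_EFinP.
  - move=> w _; rewrite -EFinM lee_fin indicE; have [wA|_] := boolP (w \in A); last first.
      by rewrite mulr0 ch_ge0.
    rewrite mulr1; apply: le_trans (expR_le_ch _).
    rewrite ler_pM2r// ler_expR nrmZ ger0_norm// -st ler_wpM2l//.
    rewrite -(@ler_pXn2r _ 2)// ?nnegrE ?nrm_ge0// sqr_nrm t2 ltW//.
    by move: wA; rewrite inE.
have PA : P A = (fine (P A))%:E by rewrite fineK// fin_num_measure.
rewrite PA -EFinM !lee_fin => h.
apply: le_trans (two_expR_le u2).
rewrite -(ler_pM2l c0); apply: (le_trans h).
rewrite (_ : _ * (2 * _) = expR (4 * u ^+ 2) * expR (- (2 * u ^+ 2))); last by field.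
by rewrite -expRD ler_expR; apply: eq_ler; ring.
Qed.

Section Interleave.
Context {R : realType} {d : measure_display} {T : measurableType d}.
Variables (P : probability T R) (n : nat) (X e : nat -> T -> R).
Hypothesis iid : iid_model P n X e.

(* A single independent sequence X_0, e_0, X_1, e_1, ...: its past at time 2i+1
   contains X_i, on which the i-th noise summand e_i a(X_i) is conditioned. *)
Definition interleave (j : nat) : T -> R := if odd j then e j./2 else X j./2.

Lemma interleave_even i : interleave i.*2 = X i.
Proof. by rewrite /interleave odd_double doubleK. Qed.

Lemma interleave_odd i : interleave i.*2.+1 = e i.
Proof. by rewrite /interleave /= odd_double uphalf_double. Qed.

Lemma measurable_interleave j : measurable_fun setT (interleave j).
Proof.
by case: iid => m _ _ _; rewrite /interleave; case: ifP => _; case: (m j./2).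
Qed.

Lemma big_double (F : nat -> \bar R) k :
  (\prod_(j < k.*2) F j = \prod_(i < k) (F i.*2 * F i.*2.+1))%E.
Proof.
elim: k => [|k IH]; first by rewrite !big_ord0.
by rewrite doubleS !big_ord_recr /= IH muleA.
Qed.

Lemma interleave_indep (B : nat -> set R) : (forall j, measurable (B j)) ->
  P (\bigcap_(j in `I_n.*2) interleave j @^-1` B j) =
  (\prod_(j < n.*2) P (interleave j @^-1` B j))%E.
Proof.
move=> mB; case: iid => _ _ _ /(_ (fun i => B i.*2) (fun i => B i.*2.+1)) H.
have -> : \bigcap_(j in `I_n.*2) interleave j @^-1` B j =
    \bigcap_(i in `I_n) (X i @^-1` B i.*2 `&` e i @^-1` B i.*2.+1).
  apply/seteqP; split => [w Bw i /= ni|w Bw j /= jn].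
    split.
      by have := Bw i.*2; rewrite /= interleave_even ltn_double; exact.
    by have := Bw i.*2.+1; rewrite /= interleave_odd ltn_Sdouble; exact.
  have [i [ni jE]] : exists i, (i < n)%N /\ (j = i.*2 \/ j = i.*2.+1).
    exists j./2; rewrite ltn_half_double; split => //.
    by have := odd_double_half j; case: (odd j) => jE; [right|left]; rewrite -[LHS]jE.
  have [Xi ei] := Bw i ni.
  by case: jE => ->; rewrite /preimage/= ?interleave_even ?interleave_odd.
rewrite H; last by move=> i; split; exact: mB.
rewrite (big_double (fun j => P (interleave j @^-1` B j))).
by apply: eq_bigr => i _; rewrite interleave_even interleave_odd.
Qed.

Variable J : finType.

Let measurable_past k j := @past_measurable _ _ _ interleave k j.

Lemma centered_mgf (v : J -> R -> R) (c : R) k : (k <= n)%N ->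
  (forall l, measurable_fun setT (v l)) ->
  (forall z, nrm (v ^~ z) <= c) ->
  (forall l, \int[uniform_prob (@ltr01 R)]_z (v l z)%:E = 0)%E ->
  (\int[P]_w (ch (nrm (fun l => \sum_(i < k) v l (X i w))))%:E <=
   (expR (2 * c ^+ 2 * k%:R))%:E)%E.
Proof.
move=> + mv vc v0; elim: k => [kn|k IH kn].
  under eq_integral.
    move=> w _; rewrite (_ : nrm _ = 0); last first.
      by rewrite /nrm /dot big1 ?sqrtr0// => l _; rewrite big_ord0 mul0r.
    over.
  rewrite integral_cst// mulr0 expR0 [leLHS](_ : _ = 1%:E)//.
  rewrite -[RHS]mule1; congr (_ * _)%E; last exact: probability_setT.
  by rewrite /ch oppr0 expR0 divff.
under eq_integral do under eq_fun do rewrite big_ord_recr /=.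
have k2 : (k.*2 < n.*2)%N by rewrite ltn_double.
have lawX B : measurable B -> P (interleave k.*2 @^-1` B) = uniform_prob (@ltr01 R) B.
  by move=> mB; case: iid => _ H _ _; rewrite interleave_even H.
have mS l : measurable_fun setT
    ((fun w => \sum_(i < k) v l (X i w)) : g_sigma_algebraType (past interleave k.*2) -> R).
  apply: measurable_sum => i; apply: measurableT_comp => //.
  rewrite -(interleave_even i); apply: measurable_past.
  by rewrite ltn_double.
have := @centered_step _ _ _ P interleave n.*2 measurable_interleave interleave_indep
   k.*2 (uniform_prob (@ltr01 R)) k2 lawX J (fun l w => \sum_(i < k) v l (X i w)) v c mS mv vc v0.
rewrite interleave_even => /le_trans; apply.
rewrite (_ : 2 * c ^+ 2 * k.+1%:R = 2 * c ^+ 2 + 2 * c ^+ 2 * k%:R); last first.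
  by rewrite -[k.+1%:R]natr1; ring.
rewrite expRD EFinM; apply: lee_wpmul2l; first by rewrite lee_fin expR_ge0.
exact: IH (ltnW kn).
Qed.

Lemma noise_mgf (a : J -> R -> R) (c : R) k : (k <= n)%N ->
  (forall l, measurable_fun setT (a l)) ->
  (forall z, nrm (a ^~ z) <= c) ->
  (\int[P]_w (ch (nrm (fun l => \sum_(i < k) e i w * a l (X i w))))%:E <=
   (expR (c ^+ 2 / 2 * k%:R))%:E)%E.
Proof.
move=> + ma ac; elim: k => [kn|k IH kn].
  under eq_integral.
    move=> w _; rewrite (_ : nrm _ = 0); last first.
      by rewrite /nrm /dot big1 ?sqrtr0// => l _; rewrite big_ord0 mul0r.
    over.
  rewrite integral_cst// mulr0 expR0 [leLHS](_ : _ = 1%:E)//.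
  rewrite -[RHS]mule1; congr (_ * _)%E; last exact: probability_setT.
  by rewrite /ch oppr0 expR0 divff.
under eq_integral do under eq_fun do rewrite big_ord_recr /=.
have k2 : (k.*2.+1 < n.*2)%N by rewrite ltn_Sdouble.
have laweps B : measurable B -> P (interleave k.*2.+1 @^-1` B) = normal_prob 0 1 B.
  by move=> mB; case: iid => _ _ H _; rewrite interleave_odd H.
have mX i : (i <= k)%N -> measurable_fun setT
    (X i : g_sigma_algebraType (past interleave k.*2.+1) -> R).
  move=> ik; rewrite -(interleave_even i); apply: measurable_past.
  by rewrite ltnS leq_double.
have me i : (i < k)%N -> measurable_fun setT
    (e i : g_sigma_algebraType (past interleave k.*2.+1) -> R).
  move=> ik; rewrite -(interleave_odd i); apply: measurable_past.
  by rewrite ltnS ltn_double.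
have mS l : measurable_fun setT
    ((fun w => \sum_(i < k) e i w * a l (X i w)) :
      g_sigma_algebraType (past interleave k.*2.+1) -> R).
  apply: measurable_sum => i; apply: measurable_funM; first exact: me.
  by apply: measurableT_comp => //; exact: mX (ltnW _).
have ma' l : measurable_fun setT
    ((fun w => a l (X k w)) : g_sigma_algebraType (past interleave k.*2.+1) -> R).
  by apply: measurableT_comp => //; exact: mX.
have := @gaussian_step _ _ _ P interleave n.*2 measurable_interleave interleave_indep
   k.*2.+1 (normal_prob 0 1) k2 laweps J (fun l w => \sum_(i < k) e i w * a l (X i w))
   (fun l w => a l (X k w)) c (fun B _ => erefl) mS ma' (fun w => ac (X k w)).
rewrite interleave_odd => /le_trans; apply.
rewrite (_ : c ^+ 2 / 2 * k.+1%:R = c ^+ 2 / 2 + c ^+ 2 / 2 * k%:R); last first.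
  by rewrite -[k.+1%:R]natr1; ring.
rewrite expRD EFinM; apply: lee_wpmul2l; first by rewrite lee_fin expR_ge0.
exact: IH (ltnW kn).
Qed.

Let mXT i : measurable_fun setT (X i).
Proof. by case: iid => m _ _ _; case: (m i). Qed.

Let meT i : measurable_fun setT (e i).
Proof. by case: iid => m _ _ _; case: (m i). Qed.

Lemma centered_tail (v : J -> R -> R) (c u : R) : (0 < n)%N -> 0 < c -> 0 <= u ->
  ln 2 <= u ^+ 2 ->
  (forall l, measurable_fun setT (v l)) ->
  (forall z, nrm (v ^~ z) <= c) ->
  (forall l, \int[uniform_prob (@ltr01 R)]_z (v l z)%:E = 0)%E ->
  let A := [set w | 16 * n%:R * c ^+ 2 * u ^+ 2 <
    dot (fun l => \sum_(i < n) v l (X i w)) (fun l => \sum_(i < n) v l (X i w))] in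
  measurable A /\ (P A <= (expR (- u ^+ 2))%:E)%E.
Proof.
move=> n0 c0 u0 u2 mv vc v0 /=.
have -> : 16 * n%:R * c ^+ 2 * u ^+ 2 = 8 * (2 * n%:R * c ^+ 2) * u ^+ 2 by ring.
apply: (@tail_of_mgf _ _ _ P J (fun l w => \sum_(i < n) v l (X i w))) => //.
- by move=> l; apply: measurable_sum => i; apply: measurableT_comp.
- by rewrite !mulr_gt0 ?exprn_gt0 ?ltr0n.
move=> s s0.
under eq_integral do under eq_fun do rewrite mulr_sumr.
have -> : 2 * n%:R * c ^+ 2 * s ^+ 2 = 2 * (s * c) ^+ 2 * n%:R by ring.
apply: (@centered_mgf (fun l z => s * v l z)) => //.
- by move=> l; apply: measurable_funM.
- by move=> z; rewrite nrmZ ger0_norm// ler_wpM2l.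
- move=> l; under eq_integral do rewrite EFinM.
  have iv := @coordinate_integrable _ _ (uniform_prob (@ltr01 R)) v c l mv vc.
  by rewrite integralZl// v0 mule0.
Qed.

Lemma noise_tail (a : J -> R -> R) (c u : R) : (0 < n)%N -> 0 < c -> 0 <= u ->
  ln 2 <= u ^+ 2 ->
  (forall l, measurable_fun setT (a l)) ->
  (forall z, nrm (a ^~ z) <= c) ->
  let A := [set w | 4 * n%:R * c ^+ 2 * u ^+ 2 <
    dot (fun l => \sum_(i < n) e i w * a l (X i w))
        (fun l => \sum_(i < n) e i w * a l (X i w))] in
  measurable A /\ (P A <= (expR (- u ^+ 2))%:E)%E.
Proof.
move=> n0 c0 u0 u2 ma ac /=.
have -> : 4 * n%:R * c ^+ 2 * u ^+ 2 = 8 * (n%:R * c ^+ 2 / 2) * u ^+ 2 by field.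
apply: (@tail_of_mgf _ _ _ P J (fun l w => \sum_(i < n) e i w * a l (X i w))) => //.
- move=> l; apply: measurable_sum => i; apply: measurable_funM => //.
  by apply: measurableT_comp.
- by rewrite !mulr_gt0 ?exprn_gt0 ?ltr0n.
move=> s s0.
under eq_integral do under eq_fun do rewrite mulr_sumr.
under eq_integral do under eq_fun do under eq_bigr do rewrite mulrCA.
have -> : n%:R * c ^+ 2 / 2 * s ^+ 2 = (s * c) ^+ 2 / 2 * n%:R by field.
apply: (@noise_mgf (fun l z => s * a l z)) => //.
- by move=> l; apply: measurable_funM.
- by move=> z; rewrite nrmZ ger0_norm// ler_wpM2l.
Qed.

End Interleave.

(** * The Sobolev space *)

Section Sobolev.
Context {R : realType}.
Local Notation mu := (@lebesgue_measure R).
Implicit Types f g u : R -> R.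

Definition l2 f := measurable_fun `[(0:R), 1] f /\
  mu.-integrable `[(0:R), 1] (fun x => (f x ^+ 2)%:E).

Lemma l2_mul f g : l2 f -> l2 g -> mu.-integrable `[(0:R), 1] (fun x => (f x * g x)%:E).
Proof.
move=> [mf i1] [mg i2].
apply: (le_integrable _ _ _ (integrableD _ i1 i2)) => //.
- by apply/measurable_EFinP; apply: measurable_funM.
- move=> x _; rewrite /= lee_fin [leRHS]ger0_norm ?addr_ge0 ?sqr_ge0//.
  rewrite normrM -[f x ^+ 2]real_normK ?num_real// -[g x ^+ 2]real_normK ?num_real//.
  have := sqr_ge0 (`|f x| - `|g x|); have := normr_ge0 (f x); have := normr_ge0 (g x); nra.
Qed.

Lemma l2_lin (a b : R) f g : l2 f -> l2 g -> l2 (fun x => a * f x + b * g x).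
Proof.
move=> Lf Lg; have [mf i1] := Lf; have [mg i2] := Lg; have i3 := l2_mul Lf Lg; split.
  by apply: measurable_funD; apply: measurable_funM.
have -> : (fun x => ((a * f x + b * g x) ^+ 2)%:E) =
    ((fun x => (a ^+ 2)%:E * (f x ^+ 2)%:E) \+
     ((fun x => (2 * a * b)%:E * (f x * g x)%:E) \+
      (fun x => (b ^+ 2)%:E * (g x ^+ 2)%:E)))%E.
  by apply/funext => x; rewrite /= -!EFinM -!EFinD; congr EFin; ring.
by apply: integrableD => //; [|apply: integrableD => //]; apply: integrableZl.
Qed.

Lemma Vf_lin (a b : R) f g u : l2 f -> l2 g -> l2 u ->
  Vf (fun x => a * f x + b * g x) u = a * Vf f u + b * Vf g u.
Proof.
move=> Lf Lg Lu; rewrite /Vf /RintI.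
have i1 := l2_mul Lf Lu; have i2 := l2_mul Lg Lu.
rewrite -RintegralZl// -RintegralZl// -RintegralD//.
- by apply: eq_Rintegral => x _; ring.
- exact: (integrableZl _ a i1).
- exact: (integrableZl _ b i2).
Qed.

Lemma Vf_sym f g : Vf f g = Vf g f.
Proof. by apply: eq_Rintegral => x _; rewrite mulrC. Qed.

Lemma Vf_linr (a b : R) f g u : l2 f -> l2 g -> l2 u ->
  Vf u (fun x => a * f x + b * g x) = a * Vf u f + b * Vf u g.
Proof. by move=> *; rewrite Vf_sym Vf_lin// (Vf_sym f u) (Vf_sym g u). Qed.

Lemma Vf_ge0 f : 0 <= Vf f f.
Proof. by apply: Rintegral_ge0 => x _; rewrite -expr2 sqr_ge0. Qed.

Lemma Vf_eq0 f : (forall x, 0 <= x <= 1 -> f x = 0) -> Vf f f = 0.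
Proof.
move=> f0; rewrite /Vf /RintI (@eq_Rintegral _ _ _ _ _ (fun=> 0)); last first.
  by move=> x; rewrite inE/= in_itv/= => /f0 ->; rewrite mul0r.
by rewrite Rintegral_cst//= mul0r.
Qed.

(** Lebesgue differentiation: the primitive of the extension of [f] by zero vanishes identically,
    hence so does its derivative, which is [f] almost everywhere on the interval. *)
Lemma int_ae0 f : mu.-integrable `[(0:R), 1] (fun x => (f x)%:E) ->
  (forall x, 0 <= x <= 1 -> RintI 0 x f = 0) ->
  {ae mu, forall x, 0 <= x <= 1 -> f x = 0}.
Proof.
move=> fi f0; pose F := f \_ `[(0:R), 1].
have Fi : mu.-integrable setT (EFin \o F).
  by rewrite /F -restrict_EFin -integrable_mkcond.
have loc : locally_integrable setT F by apply: integrable_locally.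
have FE x : F x = if 0 <= x <= 1 then f x else 0.
  by rewrite /F patchE mem_setE in_itv.
clearbody F.
(* The primitive starts at -1, so that every point of the unit interval, 0 included, lies strictly
   to the right of the base point. *)
have F0 y : Rintegral mu [set` Interval (BLeft (-1)) (BRight y)] F = 0.
  rewrite Rintegral_mkcond; pose z := Num.min 1 y.
  have [y0|y0] := ltP y 0.
    rewrite (@eq_Rintegral _ _ _ _ _ (fun=> 0)).
      by rewrite /Rintegral integral0.
    move=> x _; rewrite patchE mem_setE in_itv/= FE; case: ifP => // /andP[_ xy].
    by rewrite leNgt (le_lt_trans xy y0).
  have z01 : 0 <= z <= 1 by rewrite /z le_min ler01 y0 ge_min lexx.
  rewrite -[RHS](f0 z z01) /RintI [RHS]Rintegral_mkcond.
  apply: eq_Rintegral => x _; rewrite !patchE !mem_setE !in_itv/= FE /z le_min.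
  have [x0|x0] := leP 0 x; last by case: ifP.
  have -> /= : -1 <= x by apply: le_trans x0; rewrite lerN10.
  by case: (x <= y); case: (x <= 1).
have Fy y : mu.-integrable [set` Interval (BLeft (-1)) (BRight y)] (EFin \o F).
  by apply: integrableS Fi.
have := FTC1 Fy loc.
apply: filterS; first exact: (ae_filter_ringOfSetsType mu).
move=> x /= H /andP[x0 x1].
have [] := H; first by rewrite lte_fin (lt_le_trans _ x0)// ltrN10.
move=> _; rewrite (_ : (fun _ => _) = cst 0); last by apply/funext => y; exact: F0.
by rewrite derive1_cst FE x0 x1.
Qed.

(** A nonzero value would persist on a nondegenerate interval inside the unit interval, which no
    null set contains. *)
Lemma ae0_continuous f : {within `[(0:R), 1], continuous f} ->
  {ae mu, forall x, 0 <= x <= 1 -> f x = 0} -> forall x, 0 <= x <= 1 -> f x = 0.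
Proof.
move=> cf [A [mA A0 sA]] x x01; apply/eqP; apply/negP => /negP fx0.
have xI : `[(0:R), 1]%classic x by rewrite /= in_itv.
have := cf x; rewrite /continuous_at => /cvgr_neq0; rewrite /from_subspace.
move=> /(_ fx0); rewrite {1}/nbhs /= -nbhs_subspace_in//.
rewrite /prop_near1 /within /= => /nbhs_ballP[e /= e0 H].
pose a := Num.max 0 (x - e / 2); pose b := Num.min 1 (x + e / 2).
have ab : a < b.
  case/andP: x01 => x0 x1.
  by rewrite /a /b gt_max !lt_min; apply/andP; split; apply/andP; split; lra.
have sub : `[a, b]%classic `<=` A.
  move=> y; rewrite /= in_itv/= /a /b ge_max le_min => /andP[/andP[y0 y1] /andP[y2 y3]].
  apply: sA => /= K.
  have yI : `[(0:R), 1]%classic y by rewrite /= in_itv/= y0.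
  have := H y; rewrite /ball /= => /(_ _ yI) h.
  have : f y != 0 by apply: h; rewrite ltr_norml; apply/andP; split; lra.
  by rewrite K ?eqxx ?y0.
have : (mu `[a, b] <= mu A)%E by apply: le_measure => //; rewrite inE.
rewrite A0 lebesgue_measure_itv/= lte_fin ab -EFinD lee_fin.
lra.
Qed.

Lemma sobolev_rep_lin m (a b : R) f f' (g g' : nat -> R -> R) :
  sobolev_rep m f g -> sobolev_rep m f' g' ->
  sobolev_rep m (fun x => a * f x + b * f' x) (fun j x => a * g j x + b * g' j x).
Proof.
move=> [h1 h2 h3 h4] [k1 k2 k3 k4]; split.
- by move=> x x01; rewrite h1// k1.
- exact: l2_lin.
- move=> j jm; have [i1 e1] := h3 j jm; have [i2 e2] := k3 j jm; split.
    rewrite (_ : (fun x => _) = ((fun x => a%:E * (g j.+1 x)%:E) \+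
      (fun x => b%:E * (g' j.+1 x)%:E))%E).
      by apply: integrableD => //; apply: integrableZl.
    by apply/funext => x.
  move=> x x01; rewrite e1// e2// /RintI.
  have sx : `[(0:R), x]%classic `<=` `[(0:R), 1]%classic.
    by case/andP: x01 => _ x1 y; rewrite /= !in_itv/= => /andP[-> /le_trans]; apply.
  have i1' : mu.-integrable `[(0:R), x] (fun x => (g j.+1 x)%:E).
    by apply: integrableS i1.
  have i2' : mu.-integrable `[(0:R), x] (fun x => (g' j.+1 x)%:E).
    by apply: integrableS i2.
  rewrite RintegralD//; last 2 first.
  + exact: (integrableZl _ a i1').
  + exact: (integrableZl _ b i2').
  by rewrite !RintegralZl//; ring.
- exact: l2_lin.
Qed.

Lemma sobolev_rep_continuous m f (g : nat -> R -> R) j : sobolev_rep m f g -> (j < m)%N ->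
  {within `[(0:R), 1], continuous (g j)}.
Proof.
move=> [h1 h2 h3 h4] jm; have [i1 e1] := h3 j jm.
have := @parameterized_integral_continuous R 0 1 (g j.+1) ler01 i1.
move=> C; have C' : {within `[(0:R), 1], continuous
    (fun x => g j 0 + Rintegral mu `[0, x] (g j.+1))}.
  move=> x; apply: cvgD; [exact: cvg_cst|exact: C].
apply: subspace_eq_continuous C' => x; rewrite inE /= in_itv/= => x01.
by rewrite /from_subspace (e1 _ x01).
Qed.

(** Uniqueness of weak derivatives, needed because [sobD] is an arbitrary choice. Vanishing climbs
    one order at a time: almost everywhere by differentiating the primitive, then everywhere by
    continuity below order [m]. The top derivative vanishes only almost everywhere. *)
Lemma sobolev_rep_eq0 m f (g : nat -> R -> R) : (forall x, 0 <= x <= 1 -> f x = 0) ->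
  sobolev_rep m f g -> {ae mu, forall x, 0 <= x <= 1 -> g m x = 0}.
Proof.
move=> f0 rep; have [h1 h2 h3 h4] := rep.
have ae_step j : (j < m)%N -> (forall x, 0 <= x <= 1 -> g j x = 0) ->
    {ae mu, forall x, 0 <= x <= 1 -> g j.+1 x = 0}.
  move=> jm gj0; have [i1 e1] := h3 j jm; apply: int_ae0 => // x x01.
  have := e1 x x01; rewrite !gj0 ?lexx ?ler01// add0r => <-.
  by [].
have all0 j : (j < m)%N -> forall x, 0 <= x <= 1 -> g j x = 0.
  elim: j => [|j IH] jm; first by move=> x x01; rewrite h1// f0.
  apply: ae0_continuous; first exact: sobolev_rep_continuous rep jm.
  by apply: ae_step; [exact: ltnW|exact: IH (ltnW jm)].
case: m rep h3 h4 ae_step all0 => [|m] rep h3 h4 ae_step all0.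
  apply: (@filterS _ _ (ae_filter_ringOfSetsType mu) setT); last exact: filterT.
  by move=> x _ x01; rewrite h1// f0.
by apply: ae_step => //; exact: all0.
Qed.

Lemma SobolevP m f : Sobolev m f ->
  exists2 g, sobolev_rep m f g & sobD m f = g m.
Proof.
move=> Sf; rewrite /sobD; case: pselect => // H.
by exists (projT1 (cid H)) => //; exact: (projT2 (cid H)).
Qed.

Lemma Sobolev_lin m (a b : R) f g : Sobolev m f -> Sobolev m g ->
  Sobolev m (fun x => a * f x + b * g x).
Proof.
by move=> [p Hp] [q Hq]; exists (fun j x => a * p j x + b * q j x); exact: sobolev_rep_lin.
Qed.

Lemma Sobolev_l2 m f : Sobolev m f -> l2 f.
Proof. by move=> [g []]. Qed.

Lemma sobD_l2 m f : Sobolev m f -> l2 (sobD m f).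
Proof. by move=> /SobolevP[g [_ _ _ H] ->]. Qed.

Lemma sobD_lin m (a b : R) f g : Sobolev m f -> Sobolev m g ->
  {ae mu, forall x, 0 <= x <= 1 ->
    sobD m (fun x => a * f x + b * g x) x = a * sobD m f x + b * sobD m g x}.
Proof.
move=> Sf Sg; have [p Hp ->] := SobolevP Sf; have [q Hq ->] := SobolevP Sg.
have [r Hr ->] := SobolevP (Sobolev_lin a b Sf Sg).
(* The chosen representative of the combination minus the combination of the chosen ones represents
   the zero function. *)
have H := sobolev_rep_lin 1 (-1) Hr (sobolev_rep_lin a b Hp Hq).
have z x : 0 <= x <= 1 ->
    1 * (a * f x + b * g x) + -1 * (a * f x + b * g x) = 0 by move=> _; ring.
have := sobolev_rep_eq0 z H; apply: filterS; first exact: (ae_filter_ringOfSetsType mu).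
move=> x /= e0 x01; have := e0 x01; lra.
Qed.

Lemma ae_RintI f g : measurable_fun `[(0:R), 1] f -> measurable_fun `[(0:R), 1] g ->
  {ae mu, forall x, 0 <= x <= 1 -> f x = g x} -> RintI 0 1 f = RintI 0 1 g.
Proof.
move=> mf mg fg; rewrite /RintI /Rintegral; congr fine; apply: ae_eq_integral => //.
- exact/measurable_EFinP.
- exact/measurable_EFinP.
- apply: filterS fg; first exact: (ae_filter_ringOfSetsType mu).
  by move=> x /= H; rewrite in_itv/= => /H ->.
Qed.

Lemma Jf_lin m (a b : R) f g u : Sobolev m f -> Sobolev m g -> Sobolev m u ->
  Jf m (fun x => a * f x + b * g x) u = a * Jf m f u + b * Jf m g u.
Proof.
move=> Sf Sg Su.
have Lf := sobD_l2 Sf; have Lg := sobD_l2 Sg; have Lu := sobD_l2 Su.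
rewrite -(Vf_lin a b Lf Lg Lu) /Jf /Vf.
apply: ae_RintI.
- apply: measurable_funM; last by case: Lu.
  by case: (sobD_l2 (Sobolev_lin a b Sf Sg)).
- by apply: measurable_funM; [case: (l2_lin a b Lf Lg)|case: Lu].
apply: filterS (sobD_lin a b Sf Sg); first exact: (ae_filter_ringOfSetsType mu).
by move=> x /= H x01; rewrite H.
Qed.

Lemma Jf_sym m f g : Jf m f g = Jf m g f.
Proof. by apply: eq_Rintegral => x _; rewrite mulrC. Qed.

Lemma Jf_linr m (a b : R) f g u : Sobolev m f -> Sobolev m g -> Sobolev m u ->
  Jf m u (fun x => a * f x + b * g x) = a * Jf m u f + b * Jf m u g.
Proof. by move=> *; rewrite Jf_sym Jf_lin// (Jf_sym m f u) (Jf_sym m g u). Qed.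

Lemma Jf_ge0 m f : 0 <= Jf m f f.
Proof. exact: Vf_ge0. Qed.

Lemma Jf_CS m f g : Sobolev m f -> Sobolev m g ->
  Jf m f g ^+ 2 <= Jf m f f * Jf m g g.
Proof.
move=> Sf Sg; apply: quad_disc; rewrite ?Jf_ge0// => a b.
have Sl := Sobolev_lin a b Sf Sg.
have := Jf_ge0 m (fun x => a * f x + b * g x).
rewrite Jf_lin// !Jf_linr// [Jf m g f]Jf_sym.
by move=> H; apply: (le_trans H); apply: eq_ler; ring.
Qed.

(** * The penalized inner product and its norm *)

Section Inner.
Variables (m : nat) (lam : R).
Hypothesis lam0 : 0 < lam.
Local Notation S := (Sobolev m).
Local Notation "'<|' f , g '|>'" := (inner m lam f g) (f, g at level 99).
Local Notation N := (normS m lam).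

Lemma inner_lin (a b : R) f g u : S f -> S g -> S u ->
  <| (fun x => a * f x + b * g x), u |> = a * <| f, u |> + b * <| g, u |>.
Proof.
move=> Sf Sg Su; rewrite /inner Vf_lin; [|exact: Sobolev_l2 Sf|exact: Sobolev_l2 Sg|exact: Sobolev_l2 Su].
by rewrite Jf_lin//; ring.
Qed.

Lemma inner_sym f g : <| f, g |> = <| g, f |>.
Proof. by rewrite /inner Vf_sym Jf_sym. Qed.

Lemma inner_linr (a b : R) f g u : S f -> S g -> S u ->
  <| u, (fun x => a * f x + b * g x) |> = a * <| u, f |> + b * <| u, g |>.
Proof. by move=> *; rewrite inner_sym inner_lin// (inner_sym f u) (inner_sym g u). Qed.

Lemma inner_ge0 f : 0 <= <| f, f |>.
Proof. by rewrite addr_ge0 ?Vf_ge0// mulr_ge0 ?Jf_ge0 ?ltW. Qed.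

Lemma normS_ge0 f : 0 <= N f.
Proof. exact: sqrtr_ge0. Qed.

Lemma sqr_normS f : N f ^+ 2 = <| f, f |>.
Proof. by rewrite sqr_sqrtr// inner_ge0. Qed.

Lemma inner_CS f g : S f -> S g -> `| <| f, g |> | <= N f * N g.
Proof.
move=> Sf Sg.
rewrite -(@ler_pXn2r _ 2)// ?nnegrE ?mulr_ge0 ?normS_ge0// exprMn !sqr_normS.
rewrite real_normK ?num_real//; apply: quad_disc; rewrite ?inner_ge0// => a b.
have := inner_ge0 (fun x => a * f x + b * g x).
have Sl := Sobolev_lin a b Sf Sg.
rewrite inner_lin// !inner_linr// [<| g, f |>]inner_sym.
by move=> H; apply: (le_trans H); apply: eq_ler; ring.
Qed.

Lemma sqr_normS_lin (a b : R) f g : S f -> S g ->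
  N (fun x => a * f x + b * g x) ^+ 2 =
  a ^+ 2 * N f ^+ 2 + 2 * a * b * <| f, g |> + b ^+ 2 * N g ^+ 2.
Proof.
move=> Sf Sg; have Sl := Sobolev_lin a b Sf Sg.
rewrite !sqr_normS inner_lin// !inner_linr// [<| g, f |>]inner_sym; ring.
Qed.

Lemma normS_triangle (a b : R) f g : S f -> S g ->
  N (fun x => a * f x + b * g x) <= `|a| * N f + `|b| * N g.
Proof.
move=> Sf Sg; have f0 := normS_ge0 f; have g0 := normS_ge0 g.
rewrite -(@ler_pXn2r _ 2)// ?nnegrE ?normS_ge0 ?addr_ge0 ?mulr_ge0// sqr_normS_lin//.
rewrite sqrrD !exprMn !real_normK ?num_real// lerD2r lerD2l.
rewrite (_ : (_ * _) *+ 2 = 2 * (`|a * b| * (N f * N g))); last by rewrite normrM; ring.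
have := inner_CS Sf Sg; have := ler_norm (a * b * <| f, g |>).
rewrite normrM => h1 h2; have := ler_wpM2l (normr_ge0 (a * b)) h2; lra.
Qed.

Lemma Vf_le_normS f : Vf f f <= N f ^+ 2.
Proof. by rewrite sqr_normS /inner lerDl mulr_ge0 ?Jf_ge0 ?ltW. Qed.

Lemma Vf_CS f g : S f -> S g -> `|Vf f g| <= N f * N g.
Proof.
move=> Sf Sg; have Lf := Sobolev_l2 Sf; have Lg := Sobolev_l2 Sg.
have h : Vf f g ^+ 2 <= Vf f f * Vf g g.
  apply: quad_disc; rewrite ?Vf_ge0// => a b.
  have := Vf_ge0 (fun x => a * f x + b * g x).
  have Ll := l2_lin a b Lf Lg.
  rewrite Vf_lin// !Vf_linr// [Vf g f]Vf_sym.
  by move=> H; apply: (le_trans H); apply: eq_ler; ring.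
rewrite -(@ler_pXn2r _ 2)// ?nnegrE ?mulr_ge0 ?normS_ge0// exprMn.
rewrite real_normK ?num_real//; apply: (le_trans h).
by rewrite ler_pM ?Vf_ge0 ?Vf_le_normS.
Qed.

Lemma Sobolev0 : S (fun=> 0 : R).
Proof.
have l0 : l2 (fun=> 0 : R).
  split => //; rewrite (_ : (fun x => _) = cst 0%E); first exact: integrable0.
  by apply/funext => x /=; rewrite expr0n.
exists (fun _ _ => 0); split => // j jm; split; first exact: integrable0.
by move=> x _; rewrite /RintI Rintegral_cst//= mul0r addr0.
Qed.

Lemma Sobolev_sum n (c : nat -> R) (F : nat -> R -> R) :
  (forall i, (i < n)%N -> S (F i)) -> S (fun x => \sum_(i < n) c i * F i x).
Proof.
elim: n => [|n IH] SF.
  by under eq_fun do rewrite big_ord0; exact: Sobolev0.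
under eq_fun do rewrite big_ord_recr /=.
have := @Sobolev_lin m 1 (c n) _ _ (IH (fun i h => SF i (ltnW h))) (SF n (ltnSn n)).
by under eq_fun do rewrite mul1r.
Qed.

Lemma inner_sum n (c : nat -> R) (F : nat -> R -> R) u :
  (forall i, (i < n)%N -> S (F i)) -> S u ->
  <| (fun x => \sum_(i < n) c i * F i x), u |> = \sum_(i < n) c i * <| F i, u |>.
Proof.
move=> + Su; elim: n => [|n IH] SF.
  under eq_fun do rewrite big_ord0; rewrite big_ord0.
  have := inner_lin 0 0 Sobolev0 Sobolev0 Su; rewrite !mul0r !addr0.
  by [].
under eq_fun do rewrite big_ord_recr /=; rewrite big_ord_recr /=.
have SF' i : (i < n)%N -> S (F i) by move=> h; apply: SF; exact: ltnW.
rewrite -IH// -[X in X + _]mul1r -inner_lin//; last 2 first.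
- exact: Sobolev_sum.
- exact: SF.
by under [in RHS]eq_fun do rewrite mul1r.
Qed.

End Inner.
End Sobolev.

(** * Spectral truncation *)

(** Device for every passage to the limit in the truncation level: a fixed excess is bounded by
    residual norms, which tend to zero. *)
Lemma cvg0_le0 {R : realType} (v : nat -> R) (c : R) (n0 : nat) :
  v @ \oo --> (0 : R) -> (forall n, (n0 <= n)%N -> c <= v n) -> c <= 0.
Proof.
move=> v0 H; apply: (ler_cvg_to (cvg_cst c) v0); near=> n.
by apply: H; near: n; exists n0.
Unshelve. all: by end_near. Qed.

(** Telescoping of 1/t - 1/(t+1). The convention that 0 has inverse 0 makes the right side 2 at
    [n = 0], so the step to 1 is separate. *)
Lemma sum_inv_sqr_le {R : realType} n :
  \sum_(i < n) (i.+1%:R ^+ 2)^-1 <= 2 - n%:R^-1 :> R.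
Proof.
elim: n => [|n IH]; first by rewrite big_ord0 invr0 subr0.
rewrite big_ord_recr /=; case: n IH => [|n] IH.
  by rewrite big_ord0 add0r expr1n invr1; lra.
apply: (le_trans (lerD IH (lexx _))).
have n0 : 0 < n.+1%:R :> R by rewrite ltr0n.
rewrite -[n.+2%:R]natr1; set t : R := n.+1%:R in n0 *.
have t1 : 0 < t + 1 by lra.
have -> : (2 - t^-1 + (t + 1)^-2 = 2 - (t + 1)^-1 - (t * (t + 1) ^+ 2)^-1)%R.
  by field; rewrite !gt_eqF.
by rewrite gerBl invr_ge0 mulr_ge0 ?exprn_ge0 ?ltW.
Qed.

Lemma RintI_sum {R : realType} n (c : nat -> R) (F : nat -> R -> R) :
  (forall i, (@lebesgue_measure R).-integrable `[(0:R), 1] (EFin \o F i)) ->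
  (@lebesgue_measure R).-integrable `[(0:R), 1] (EFin \o (fun x => \sum_(i < n) c i * F i x)) /\
  RintI 0 1 (fun x => \sum_(i < n) c i * F i x) = \sum_(i < n) c i * RintI 0 1 (F i).
Proof.
move=> iF; elim: n => [|n [i1 e1]].
  rewrite (_ : (fun x => _) = fun=> 0); last by apply/funext => x; rewrite big_ord0.
  split; first exact: integrable0.
  by rewrite /RintI Rintegral_cst//= mul0r big_ord0.
have i2 : (@lebesgue_measure R).-integrable `[(0:R), 1] (EFin \o (fun x => c n * F n x)).
  exact: (integrableZl _ (c n) (iF n)).
rewrite (_ : (fun x => _) = (fun x => \sum_(i < n) c i * F i x + c n * F n x)); last first.
  by apply/funext => x; rewrite big_ord_recr.
split; first exact: (integrableD _ i1 i2).
rewrite big_ord_recr /= -e1.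
have -> : c n * RintI 0 1 (F n) = RintI 0 1 (fun x => c n * F n x).
  by symmetry; apply: RintegralZl => //; exact: iF.
by apply: RintegralD.
Qed.

Section Spectral.
Context {R : realType}.
Variables (m : nat) (lam : R) (K : R -> R -> R).
Hypothesis lam0 : 0 < lam.
Hypothesis m1 : (1 <= m)%N.
Local Notation S := (Sobolev m).
Local Notation ip := (inner m lam).
Local Notation N := (normS m lam).
Hypothesis KS : forall x, 0 <= x <= 1 -> S (K x).
Hypothesis Krep : forall x f, 0 <= x <= 1 -> S f -> ip (K x) f = f x.

Variables (phi : nat -> R -> R) (rho : nat -> R) (crho B : R).
Hypothesis c0 : 0 < crho.
Hypothesis phiS : forall nu, S (phi nu).
Hypothesis phiB : forall nu x, 0 <= x <= 1 -> `|phi nu x| <= B.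
Hypothesis rho_cvg :
  (fun nu : nat => rho nu / (crho * nu.+1%:R) ^+ (2 * m)) @ \oo --> (1 : R).
Hypothesis phiV : forall mu nu, Vf (phi mu) (phi nu) = (mu == nu)%:R.
Hypothesis phiJ : forall mu nu, Jf m (phi mu) (phi nu) = rho mu * (mu == nu)%:R.
Hypothesis phi_cvg : forall g, S g ->
  (fun n : nat => N (fun x => g x - \sum_(nu < n) Vf g (phi nu) * phi nu x)) @ \oo
    --> (0 : R).

(** The squared norm of [phi nu] for the penalized inner product. *)
Definition omega nu := 1 + lam * rho nu.
(** The eigenfunctions normalized in the penalized norm. By the reproducing property their values at
    [x] are the coordinates of [K x]. *)
Definition feat nu x := phi nu x / Num.sqrt (omega nu).
Definition trunc n (g : R -> R) x := \sum_(nu < n) Vf g (phi nu) * phi nu x.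

Lemma omega_ge1 nu : 1 <= omega nu.
Proof.
rewrite /omega lerDl mulr_ge0 ?(ltW lam0)//.
by have := phiJ nu nu; rewrite eqxx mulr1 => <-; exact: Jf_ge0.
Qed.

Lemma omega_gt0 nu : 0 < omega nu.
Proof. exact: lt_le_trans (omega_ge1 nu). Qed.

Lemma sqr_sqrt_omega nu : Num.sqrt (omega nu) ^+ 2 = omega nu.
Proof. by rewrite sqr_sqrtr// ltW// omega_gt0. Qed.

Lemma sqrt_omega_neq0 nu : Num.sqrt (omega nu) != 0.
Proof. by rewrite gt_eqF// sqrtr_gt0 omega_gt0. Qed.

Lemma ip_phi mu nu : ip (phi mu) (phi nu) = omega mu * (mu == nu)%:R.
Proof. by rewrite /inner phiV phiJ /omega; ring. Qed.

Lemma truncS n g : S (trunc n g).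
Proof. by apply: (@Sobolev_sum _ _ n (fun nu => Vf g (phi nu)) phi). Qed.

Lemma resS n g : S g -> S (fun x => g x - trunc n g x).
Proof.
move=> Sg; have := Sobolev_lin 1 (-1) Sg (truncS n g).
by under eq_fun do rewrite mul1r mulN1r.
Qed.

Lemma ip_trunc n g u : S u -> ip (trunc n g) u = \sum_(nu < n) Vf g (phi nu) * ip (phi nu) u.
Proof.
by move=> Su; exact: (@inner_sum _ m lam n (fun nu => Vf g (phi nu)) phi u (fun i _ => phiS i) Su).
Qed.

Lemma ip_trunc_phi n g nu : (nu < n)%N -> ip (trunc n g) (phi nu) = omega nu * Vf g (phi nu).
Proof.
move=> nun; rewrite ip_trunc// (bigD1 (Ordinal nun))//= big1 ?addr0.
  by rewrite ip_phi eqxx mulr1 mulrC.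
by move=> i /eqP ni; rewrite ip_phi; case: eqVneq => [E|]; rewrite ?mulr0// in ni *;
  case: ni; apply: val_inj.
Qed.

Lemma ip_res n g u : S g -> S u ->
  ip (fun x => g x - trunc n g x) u = ip g u - ip (trunc n g) u.
Proof.
move=> Sg Su; have := inner_lin lam 1 (-1) Sg (truncS n g) Su.
by under eq_fun do rewrite mul1r mulN1r; rewrite mul1r mulN1r.
Qed.

(** The expansion has coefficients taken in [V], but it converges in the penalized norm. Pairing
    with [phi nu] is continuous there, and the truncations have a constant pairing from level
    [nu.+1] on. *)
Lemma ip_coef g nu : S g -> ip g (phi nu) = omega nu * Vf g (phi nu).
Proof.
move=> Sg; apply/eqP; rewrite -subr_eq0 -normr_le0.
have cv : (fun n => N (fun x => g x - trunc n g x) * N (phi nu)) @ \oo --> (0:R).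
  by rewrite -(mul0r (N (phi nu))); apply: cvgMr_tmp; exact: phi_cvg.
apply: (cvg0_le0 (n0 := nu.+1) cv) => n nun.
rewrite -(ip_trunc_phi g nun) -ip_res//.
by apply: inner_CS => //; exact: resS.
Qed.

Lemma sqr_normS_trunc n g : N (trunc n g) ^+ 2 = \sum_(nu < n) omega nu * Vf g (phi nu) ^+ 2.
Proof.
rewrite sqr_normS// ip_trunc; last exact: truncS.
by apply: eq_bigr => nu _; rewrite inner_sym ip_trunc_phi//; ring.
Qed.

(** Truncation is an orthogonal projection: its squared norm equals its inner product with [g], and
    Cauchy-Schwarz concludes. *)
Lemma normS_trunc_le n g : S g -> N (trunc n g) <= N g.
Proof.
move=> Sg; have h0 := normS_ge0 m lam (trunc n g).
have [->|hn] := eqVneq (N (trunc n g)) 0; first exact: normS_ge0.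
have hp : 0 < N (trunc n g) by rewrite lt_neqAle eq_sym hn.
rewrite -(ler_pM2l hp) -expr2 sqr_normS_trunc.
have := inner_CS lam0 (truncS n g) Sg; apply: le_trans.
apply: le_trans (ler_norm _); rewrite ip_trunc//; apply: ler_sum => nu _.
by rewrite inner_sym ip_coef//; apply: eq_ler; ring.
Qed.

Lemma sqr_normS_K x : 0 <= x <= 1 -> N (K x) ^+ 2 = K x x.
Proof. by move=> x01; rewrite sqr_normS// Krep//; exact: KS. Qed.

Lemma eval_le f x : 0 <= x <= 1 -> S f -> `|f x| <= N (K x) * N f.
Proof. by move=> x01 Sf; rewrite -(Krep x01 Sf); apply: inner_CS => //; exact: KS. Qed.

Lemma Vf_K x nu : 0 <= x <= 1 -> Vf (K x) (phi nu) = phi nu x / omega nu.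
Proof.
move=> x01; have := ip_coef nu (KS x01); rewrite Krep// => ->.
by rewrite mulrC mulKf// gt_eqF// omega_gt0.
Qed.

Lemma sqr_feat nu x : feat nu x ^+ 2 = phi nu x ^+ 2 / omega nu.
Proof. by rewrite /feat expr_div_n sqr_sqrt_omega. Qed.

Lemma feat_bessel n x : 0 <= x <= 1 -> \sum_(nu < n) feat nu x ^+ 2 <= K x x.
Proof.
move=> x01; rewrite -sqr_normS_K//.
have h : N (trunc n (K x)) ^+ 2 <= N (K x) ^+ 2.
  by rewrite lerXn2r ?nnegrE ?normS_ge0// normS_trunc_le//; exact: KS.
apply: le_trans h; rewrite sqr_normS_trunc; apply: ler_sum => nu _.
rewrite Vf_K// sqr_feat; have o0 := omega_gt0 nu.
by apply: eq_ler; field; rewrite gt_eqF.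
Qed.

Lemma sum_inv_omega_bounded : exists C : R, forall n, \sum_(nu < n) (omega nu)^-1 <= C.
Proof.
have : \forall nu \near \oo, 2^-1 < rho nu / (crho * nu.+1%:R) ^+ (2 * m).
  by have /cvgr_gt := rho_cvg; apply; lra.
move=> [n0 _ H].
(* Beyond [n0], [rho nu] exceeds half its asymptotic value, and [m >= 1] reduces the power to a
   square; hence [D^-1 * nu.+1 ^+ 2 <= omega nu]. The first [n0] terms are at most 1 each. *)
pose D := 2 / (lam * crho ^+ (2 * m)).
have cm : 0 < lam * crho ^+ (2 * m) by rewrite mulr_gt0// exprn_gt0.
have D0 : 0 <= D by rewrite divr_ge0// ltW.
exists (n0%:R + D * 2) => n.
have step nu : (omega nu)^-1 <= (nu < n0)%N%:R + D * (nu.+1%:R ^+ 2)^-1.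
  have k0 : 0 < nu.+1%:R :> R by rewrite ltr0n.
  have D1 : 0 <= D * (nu.+1%:R ^+ 2)^-1 by rewrite mulr_ge0// invr_ge0 exprn_ge0// ltW.
  have [nun|nun] := ltnP nu n0.
    apply: (@le_trans _ _ 1); last by rewrite lerDl.
    by rewrite invf_le1 ?omega_gt0// omega_ge1.
  rewrite add0r.
  have h1 : 2^-1 < rho nu / (crho * nu.+1%:R) ^+ (2 * m) by exact: H.
  have p0 : 0 < (crho * nu.+1%:R) ^+ (2 * m) by rewrite exprn_gt0// mulr_gt0.
  have h2 : 2^-1 * (crho * nu.+1%:R) ^+ (2 * m) < rho nu by rewrite -ltr_pdivlMr.
  have h3 : nu.+1%:R ^+ 2 <= nu.+1%:R ^+ (2 * m) :> R.
    by rewrite ler_weXn2l ?ler1n// leq_pmulr.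
  have h4 : D^-1 * nu.+1%:R ^+ 2 <= omega nu.
    rewrite /omega /D invf_div.
    have : lam * (2^-1 * (crho * nu.+1%:R) ^+ (2 * m)) <= lam * rho nu.
      by rewrite ler_pM2l// ltW.
    have := ler_wpM2l (ltW cm) h3.
    rewrite exprMn; set q := nu.+1%:R ^+ (2 * m); set c := crho ^+ _.
    set k := nu.+1%:R ^+ 2; nra.
  have Dp : 0 < D by rewrite divr_gt0.
  rewrite -[D]invrK -invfM lef_pV2 ?posrE ?omega_gt0//.
  by rewrite mulr_gt0 ?invr_gt0// exprn_gt0.
apply: (@le_trans _ _ (\sum_(nu < n) ((nu < n0)%N%:R + D * (nu.+1%:R ^+ 2)^-1))).
  by apply: ler_sum => i _; exact: step.
rewrite big_split /= -mulr_sumr lerD//.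
  rewrite -natr_sum ler_nat.
  apply: (@leq_trans (\sum_(i < n0) 1)); last by rewrite sum1_card card_ord.
  have [nn|nn] := leqP n n0.
    rewrite (big_ord_widen n0 (fun i => nat_of_bool (i < n0)%N) nn).
    rewrite big_mkcond; apply: leq_sum => i _; case: ifP => // _; exact: leq_b1.
  rewrite [X in (_ <= X)%N](big_ord_widen n (fun=> 1%N) (ltnW nn)).
  by rewrite [X in (_ <= X)%N]big_mkcond; apply: leq_sum => i _; case: (i < n0)%N.
rewrite ler_wpM2l// (le_trans (sum_inv_sqr_le n))// gerBl invr_ge0.
by [].
Qed.

(** [cK] is a supremum, and it dominates its set only if that set is bounded. The uniform bound on
    the eigenfunctions and the summability of [omega nu ^-1] provide this. *)
Lemma K_diag_bounded : exists C : R, forall x, 0 <= x <= 1 -> K x x <= C.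
Proof.
have [C HC] := sum_inv_omega_bounded.
exists (B ^+ 2 * C) => x x01; rewrite -subr_le0.
have SK := KS x01.
have cv : (fun n => N (K x) * N (fun y => K x y - trunc n (K x) y)) @ \oo --> (0:R).
  by rewrite -(mulr0 (N (K x))); apply: cvgMl_tmp; exact: phi_cvg.
apply: (cvg0_le0 (n0 := 0%N) cv) => n _.
apply: le_trans (eval_le x01 (resS n SK)); apply: le_trans (ler_norm _).
rewrite lerD2l lerN2 /trunc.
apply: (@le_trans _ _ (\sum_(nu < n) B ^+ 2 * (omega nu)^-1)); last first.
  by rewrite -mulr_sumr ler_wpM2l ?sqr_ge0.
apply: ler_sum => nu _; rewrite Vf_K// mulrAC -expr2 ler_wpM2r ?invr_ge0 ?(ltW (omega_gt0 nu))//.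
have := phiB nu x01; have := normr_ge0 (phi nu x).
by move=> p0 pB; rewrite -[phi nu x ^+ 2]real_normK ?num_real// lerXn2r ?nnegrE// (le_trans p0).
Qed.

(** Bessel's inequality for [K x] integrated over [x], each [phi nu] having unit mass in [V]. The
    trace of the covariance is thus controlled by the same constant as the kernel diagonal. *)
Lemma sum_inv_omega_le n k0 : (forall x, 0 <= x <= 1 -> K x x <= k0) ->
  \sum_(nu < n) (omega nu)^-1 <= k0.
Proof.
move=> Kk0; have lp nu := Sobolev_l2 (phiS nu).
have ip2 nu := l2_mul (lp nu) (lp nu).
have [i1 e1] := RintI_sum n (fun nu => (omega nu)^-1) ip2.
have -> : \sum_(nu < n) (omega nu)^-1 = \sum_(nu < n) (omega nu)^-1 * RintI 0 1 (fun x => phi nu x * phi nu x).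
  by apply: eq_bigr => nu _; have := phiV nu nu; rewrite /Vf eqxx => ->; rewrite mulr1.
rewrite -e1.
have -> : k0 = RintI 0 1 (fun=> k0).
  by rewrite /RintI Rintegral_cst//= lebesgue_measure_itv/= lte_fin ltr01 oppr0 adde0 mulr1.
apply: le_Rintegral => //.
  apply: measurable_bounded_integrable => //.
    by rewrite /= lebesgue_measure_itv/= lte_fin ltr01 oppr0 adde0 ltry.
  by exists `|k0|; split; rewrite ?num_real// => M /ltW h x _.
move=> x; rewrite /= in_itv/= => x01.
apply: le_trans (Kk0 x x01); apply: le_trans (feat_bessel n x01).
by apply: ler_sum => nu _; rewrite sqr_feat mulrC -expr2.
Qed.

(** * From truncations to bounds for all Sobolev functions, at a fixed sample *)

Section Deterministic.
Variables (n : nat) (xs eps : nat -> R).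
Hypothesis xs01 : forall i, (i < n)%N -> 0 <= xs i <= 1.

(** Coordinate of [g] along the normalized eigenfunction [feat nu]. *)
Let gcoef nu g := Vf g (phi nu) * Num.sqrt (omega nu).

Lemma trunc_feat k g x : trunc k g x = \sum_(nu < k) gcoef nu g * feat nu x.
Proof.
apply: eq_bigr => nu _; rewrite /gcoef /feat.
by field; exact: sqrt_omega_neq0.
Qed.

Lemma nrm_gcoef k g : nrm (fun nu : 'I_k => gcoef nu g) = N (trunc k g).
Proof.
apply/eqP; rewrite -(@eqrXn2 _ 2)// ?nrm_ge0 ?normS_ge0// sqr_nrm sqr_normS_trunc.
by apply/eqP; apply: eq_bigr => nu _; rewrite /gcoef -[in RHS]sqr_sqrt_omega; ring.
Qed.

(** On a truncation of [u] this is Cauchy-Schwarz in coordinates. The rest is bounded by point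
    evaluations, with a constant that depends on the sample; this is harmless since it multiplies a
    residual tending to zero. *)
Lemma noise_bound (T2 : R) (u : R -> R) : 0 <= T2 -> S u ->
  (forall k, nrm (fun nu : 'I_k => \sum_(i < n) eps i * feat nu (xs i)) <= T2) ->
  `|\sum_(i < n) eps i * u (xs i)| <= T2 * N u.
Proof.
move=> T20 Su H.
pose C := \sum_(i < n) `|eps i| * N (K (xs i)).
rewrite -subr_le0.
have cv : (fun k => C * N (fun y => u y - trunc k u y)) @ \oo --> (0:R).
  by rewrite -(mulr0 C); apply: cvgMl_tmp; exact: phi_cvg.
apply: (cvg0_le0 (n0 := 0%N) cv) => k _.
have h1 : `|\sum_(i < n) eps i * trunc k u (xs i)| <= T2 * N u.
  have -> : \sum_(i < n) eps i * trunc k u (xs i) =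
      dot (fun nu : 'I_k => \sum_(i < n) eps i * feat nu (xs i)) (fun nu : 'I_k => gcoef nu u).
    rewrite /dot; under eq_bigr do rewrite trunc_feat mulr_sumr.
    rewrite exchange_big /=; apply: eq_bigr => nu _; rewrite mulr_suml.
    by apply: eq_bigr => i _; ring.
  apply: (le_trans (dot_CS _ _)); rewrite nrm_gcoef.
  by apply: ler_pM; rewrite ?nrm_ge0 ?normS_ge0// normS_trunc_le.
have h2 : `|\sum_(i < n) eps i * (u (xs i) - trunc k u (xs i))| <=
    C * N (fun y => u y - trunc k u y).
  apply: (le_trans (ler_norm_sum _ _ _)); rewrite /C mulr_suml; apply: ler_sum => i _.
  rewrite normrM -mulrA; apply: ler_wpM2l => //.
  exact: (eval_le (xs01 (ltn_ord i)) (resS k Su)).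
have -> : \sum_(i < n) eps i * u (xs i) = \sum_(i < n) eps i * (u (xs i) - trunc k u (xs i))
    + \sum_(i < n) eps i * trunc k u (xs i).
  by rewrite -big_split /=; apply: eq_bigr => i _; ring.
have := ler_normD (\sum_(i < n) eps i * (u (xs i) - trunc k u (xs i)))
  (\sum_(i < n) eps i * trunc k u (xs i)).
lra.
Qed.

(** [n] times the bilinear form of the empirical minus the population covariance. *)
Let bet (g u : R -> R) := \sum_(i < n) g (xs i) * u (xs i) - n%:R * Vf g u.
Let C := \sum_(i < n) N (K (xs i)) ^+ 2 + n%:R.

Lemma bet_crude g u : S g -> S u -> `|bet g u| <= C * (N g * N u).
Proof.
move=> Sg Su; apply: (le_trans (ler_normB _ _)); rewrite /C mulrDl lerD//.
  apply: (le_trans (ler_norm_sum _ _ _)); rewrite mulr_suml; apply: ler_sum => i _.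
  have := eval_le (xs01 (ltn_ord i)) Sg; have := eval_le (xs01 (ltn_ord i)) Su.
  rewrite normrM => h1 h2; have := ler_pM (normr_ge0 _) (normr_ge0 _) h2 h1.
  by move=> /le_trans; apply; apply: eq_ler; ring.
by rewrite normrM ger0_norm// ler_wpM2l//; exact: Vf_CS.
Qed.

(** In coordinates the form pairs a matrix with the rank-one matrix of the two coefficient vectors.
    Cauchy-Schwarz for matrices then brings in the Hilbert-Schmidt norm. *)
Lemma bet_trunc k g u : bet (trunc k g) (trunc k u) =
  dot (fun p : 'I_k * 'I_k => \sum_(i < n)
        (feat p.1 (xs i) * feat p.2 (xs i) - (p.1 == p.2)%:R / omega p.1))
      (fun p => gcoef p.1 g * gcoef p.2 u).
Proof.
rewrite /dot -(pair_bigA _ (fun a b : 'I_k => (\sum_(i < n)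
   (feat a (xs i) * feat b (xs i) - (a == b)%:R / omega a)) * (gcoef a g * gcoef b u)))/=.
(* [V] is read as the inner product with zero penalty so that [inner_sum] applies to it. *)
have V0 (f w : R -> R) : Vf f w = inner m 0 f w by rewrite /inner mul0r addr0.
have tr (w v : R -> R) : S v -> Vf (trunc k w) v = \sum_(nu < k) Vf w (phi nu) * Vf (phi nu) v.
  move=> Sv; rewrite V0; under eq_bigr => nu _ do rewrite (V0 (phi nu) v).
  exact: (@inner_sum _ m 0 k (fun nu => Vf w (phi nu)) phi v (fun i _ => phiS i) Sv).
rewrite /bet.
have -> : Vf (trunc k g) (trunc k u) = \sum_(nu < k) Vf g (phi nu) * Vf u (phi nu).
  rewrite tr; last exact: truncS.
  apply: eq_bigr => nu _; congr (_ * _); rewrite Vf_sym tr//.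
  rewrite (bigD1 nu)//= phiV eqxx mulr1 big1 ?addr0// => i ni.
  by rewrite phiV (_ : (_ == _) = false) ?mulr0//; apply/negbTE.
transitivity (\sum_(a < k) \sum_(b < k)
   ((\sum_(i < n) feat a (xs i) * feat b (xs i)) * (gcoef a g * gcoef b u)) -
   \sum_(a < k) \sum_(b < k) n%:R * ((a == b)%:R / omega a) * (gcoef a g * gcoef b u)).
  congr (_ - _).
    under [LHS]eq_bigr do rewrite !trunc_feat big_distrlr /=.
    rewrite exchange_big /=; apply: eq_bigr => a _.
    rewrite exchange_big /=; apply: eq_bigr => b _.
    by rewrite mulr_suml; apply: eq_bigr => i _; ring.
  rewrite mulr_sumr; apply: eq_bigr => a _.
  rewrite (bigD1 a)//= eqxx big1 ?addr0; last first.
    by move=> b /negbTE ba; rewrite eq_sym ba mul0r mulr0 mul0r.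
  have -> : true%:R = 1 :> R by [].
  rewrite /gcoef; have := sqr_sqrt_omega a; have := sqrt_omega_neq0 a.
  by move: (Num.sqrt (omega a)) => q q0 <-; field.
rewrite -sumrB; apply: eq_bigr => a _; rewrite -sumrB; apply: eq_bigr => b _.
by rewrite sumrB sumr_const card_ord -mulrBl mulr_natl.
Qed.

Lemma empirical_bound (T1 : R) (g u : R -> R) : 0 <= T1 -> S g -> S u ->
  (forall k, nrm (fun p : 'I_k * 'I_k => \sum_(i < n)
        (feat p.1 (xs i) * feat p.2 (xs i) - (p.1 == p.2)%:R / omega p.1)) <= T1) ->
  `|\sum_(i < n) g (xs i) * u (xs i) - n%:R * Vf g u| <= T1 * (N g * N u).
Proof.
move=> T10 Sg Su H; rewrite -/(bet g u) -subr_le0.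
pose rg k := (fun y => g y - trunc k g y); pose ru k := (fun y => u y - trunc k u y).
have c1 : (fun k => C * N u * N (rg k)) @ \oo --> (0:R).
  by rewrite -(mulr0 (C * N u)); apply: cvgMl_tmp; exact: phi_cvg.
have c2 : (fun k => C * N g * N (ru k)) @ \oo --> (0:R).
  by rewrite -(mulr0 (C * N g)); apply: cvgMl_tmp; exact: phi_cvg.
have cv : (fun k => C * N u * N (rg k) + C * N g * N (ru k)) @ \oo --> (0:R).
  by rewrite -[X in _ --> X]addr0; exact: (cvgD c1 c2).
apply: (cvg0_le0 (n0 := 0%N) cv) => k _.
have Cge0 : 0 <= C by rewrite addr_ge0// sumr_ge0// => i _; exact: sqr_ge0.
have Sgk := truncS k g; have Suk := truncS k u.
have SRg := resS k Sg; have SRu := resS k Su.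
have h1 : `|bet (trunc k g) (trunc k u)| <= T1 * (N g * N u).
  rewrite bet_trunc; apply: (le_trans (dot_CS _ _)); apply: ler_pM; rewrite ?nrm_ge0//.
  have -> : nrm (fun p : 'I_k * 'I_k => gcoef p.1 g * gcoef p.2 u) = N (trunc k g) * N (trunc k u).
    rewrite -!nrm_gcoef /nrm -sqrtrM ?dot_ge0//; congr Num.sqrt.
    rewrite /dot mulr_suml -(pair_bigA _ (fun a b : 'I_k =>
       gcoef a g * gcoef b u * (gcoef a g * gcoef b u)))/=.
    by apply: eq_bigr => a _; rewrite mulr_sumr; apply: eq_bigr => b _; ring.
  by apply: ler_pM; rewrite ?normS_ge0// normS_trunc_le.
have h2 : `|bet (rg k) u| <= C * N u * N (rg k).
  by apply: (le_trans (bet_crude SRg Su)); rewrite [leLHS]mulrA [leLHS]mulrAC.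
have h3 := bet_crude Sgk SRu.
have h4 : C * (N (trunc k g) * N (ru k)) <= C * N g * N (ru k).
  rewrite -[leRHS]mulrA; apply: ler_wpM2l; first exact: Cge0.
  by apply: ler_wpM2r; [exact: normS_ge0|exact: normS_trunc_le].
(* One argument is truncated at a time; the two terms with a residual fall under [bet_crude] and
   vanish in the limit. *)
have E : bet g u = bet (rg k) u + (bet (trunc k g) (ru k) + bet (trunc k g) (trunc k u)).
  have lg := Sobolev_l2 Sg; have lu := Sobolev_l2 Su.
  have lgk := Sobolev_l2 Sgk; have luk := Sobolev_l2 Suk.
  have e1 : Vf (rg k) u = Vf g u - Vf (trunc k g) u.
    have := Vf_lin 1 (-1) lg lgk lu; rewrite mul1r mulN1r => <-.
    by rewrite /rg; congr Vf; apply/funext => y; ring.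
  have e2 : Vf (trunc k g) (ru k) = Vf (trunc k g) u - Vf (trunc k g) (trunc k u).
    have := Vf_linr 1 (-1) lu luk lgk; rewrite mul1r mulN1r => <-.
    by rewrite /ru; congr Vf; apply/funext => y; ring.
  rewrite /bet e1 e2.
  have -> : \sum_(i < n) g (xs i) * u (xs i) =
     \sum_(i < n) rg k (xs i) * u (xs i) + (\sum_(i < n) trunc k g (xs i) * ru k (xs i) +
       \sum_(i < n) trunc k g (xs i) * trunc k u (xs i)).
    by rewrite -!big_split /=; apply: eq_bigr => i _; rewrite /rg /ru; ring.
  ring.
have h5 := ler_normD (bet (rg k) u) (bet (trunc k g) (ru k) + bet (trunc k g) (trunc k u)).
have h6 := ler_normD (bet (trunc k g) (ru k)) (bet (trunc k g) (trunc k u)).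
rewrite E lerBlDr; apply: (le_trans h5); rewrite -[leRHS]addrA; apply: lerD.
  exact: h2.
apply: (le_trans h6); apply: lerD; last exact: h1.
exact: le_trans h3 h4.
Qed.

End Deterministic.
End Spectral.

(** * First-order condition, and tools for the exceptional event *)

(** The derivative vanishes at an extremum, by testing [t = s * L] with [s] so small that
    [s * q < 1]. *)
Lemma lin_quad0 {R : realType} (L q : R) :
  (forall t, t * L <= t ^+ 2 * q) -> L = 0.
Proof.
move=> H; apply/eqP; rewrite -sqrf_eq0 eq_le sqr_ge0 andbT.
pose s := (`|q| + 1)^-1; have q0 : 0 < `|q| + 1 by rewrite ltr_wpDl.
have s0 : 0 < s by rewrite invr_gt0.
have sq : s * (`|q| + 1) = 1 by rewrite mulVf// gt_eqF.
have h := H (s * L); have qn := ler_norm q.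
have L2 := sqr_ge0 L.
have : s * (L ^+ 2 * (1 - s * q)) <= 0 by nra.
rewrite pmulr_rle0//.
have p : 0 < 1 - s * q by nra.
by rewrite pmulr_lle0.
Qed.

(** Along [F + t * u] the objective is a quadratic polynomial in [t] with its maximum at 0; [L] is
    its linear coefficient and [- q] its quadratic one. *)
Lemma first_order_condition {R : realType} m n (lam : R) (xs ys : nat -> R) (F u : R -> R) :
  (0 < n)%N -> Sobolev m F -> Sobolev m u ->
  (forall g, Sobolev m g -> objective m n lam xs ys g <= objective m n lam xs ys F) ->
  \sum_(i < n) (ys i - F (xs i)) * u (xs i) = n%:R * (lam * Jf m F u).
Proof.
move=> n0 SF Su opt; have nn : n%:R != 0 :> R by rewrite pnatr_eq0 -lt0n.
pose L := n%:R^-1 * \sum_(i < n) (ys i - F (xs i)) * u (xs i) - lam * Jf m F u.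
suff L0 : L = 0.
  by move/eqP: L0; rewrite subr_eq0 => /eqP <-; rewrite mulrA mulfV// mul1r.
pose q := (2 * n%:R)^-1 * \sum_(i < n) u (xs i) ^+ 2 + lam / 2 * Jf m u u.
apply: (@lin_quad0 _ _ q) => t.
have := opt _ (Sobolev_lin 1 t SF Su).
rewrite /objective Jf_lin//; last exact: Sobolev_lin.
rewrite !Jf_linr// [Jf m u F]Jf_sym.
have -> : \sum_(i < n) (ys i - (1 * F (xs i) + t * u (xs i))) ^+ 2 =
   \sum_(i < n) (ys i - F (xs i)) ^+ 2 + ((- (2 * t)) * \sum_(i < n) (ys i - F (xs i)) * u (xs i)
    + t ^+ 2 * \sum_(i < n) u (xs i) ^+ 2).
  by rewrite !mulr_sumr -!big_split /=; apply: eq_bigr => i _; ring.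
rewrite /L /q.
set A := \sum_(i < n) _ ^+ 2; set B := \sum_(i < n) _ * _; set C := \sum_(i < n) _ ^+ 2.
set J1 := Jf m F F; set J2 := Jf m F u; set J3 := Jf m u u.
rewrite -subr_le0 => h; rewrite -subr_le0; apply: le_trans h; apply: eq_ler.
by field.
Qed.

Lemma bigcup_prob_le {R : realType} {d} {T : measurableType d} (P : probability T R)
  (A : nat -> set T) (c : \bar R) : (forall k, measurable (A k)) ->
  (forall k, A k `<=` A k.+1) -> (forall k, P (A k) <= c)%E ->
  (P (\bigcup_k A k) <= c)%E.
Proof.
move=> mA ndA Pc.
have nd : nondecreasing_seq A by apply/nondecreasing_seqP => k; apply/subsetPset.
have cv : (P \o A) @ \oo --> P (\bigcup_k A k).
  by apply: nondecreasing_cvg_mu => //; exact: bigcupT_measurable.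
by apply: (lee_cvg_to cv (cvg_cst c)); apply: nearW.
Qed.

(** Adding [c] makes the integrand nonnegative; both measures give mass 1, so [c] can be subtracted
    again from each side. *)
Lemma uniform_integral {R : realType} (f : R -> R) (c : R) :
  measurable_fun setT f -> (forall x, `|f x| <= c) ->
  (\int[uniform_prob (@ltr01 R)]_x (f x)%:E = (RintI 0 1 f)%:E)%E.
Proof.
move=> mf fc.
have mf' : measurable_fun setT (f : measurableTypeR R -> R) by [].
have iu : (uniform_prob (@ltr01 R)).-integrable setT (EFin \o (f : measurableTypeR R -> R)).
  apply: measurable_bounded_integrable => //.
    by rewrite -ge0_fin_numE// fin_num_measure.
  by exists c; split; rewrite ?num_real// => M /ltW cM x _; exact: le_trans (fc x) cM.
have mu1 : @lebesgue_measure R `[(0:R), 1] = 1%E.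
  by rewrite lebesgue_measure_itv/= lte_fin ltr01 oppr0 adde0.
have bi g (e : R) : measurable_fun `[(0:R), 1] (g : measurableTypeR R -> R) -> (forall x, `|g x| <= e) ->
    (@lebesgue_measure R).-integrable `[(0:R), 1] (EFin \o g).
  move=> mg ge; apply: measurable_bounded_integrable => //.
    by rewrite /= lebesgue_measure_itv/= lte_fin ltr01 oppr0 adde0 ltry.
  by exists e; split; rewrite ?num_real// => M /ltW cM x _; exact: le_trans (ge x) cM.
have il := bi f c (measurable_funTS mf') fc.
have ilc := bi (fun=> c) `|c| (measurable_cst _) (fun _ => lexx _).
have := @integral_uniform _ _ _ (@ltr01 R) (fun x => (f x + c)%:E).
have mfc : measurable_fun setT (fun x : measurableTypeR R => (f x + c)%:E).
  by apply/measurable_EFinP; apply: measurable_funD.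
move=> /(_ mfc); rewrite subr0 invr1 mul1e => H.
have {}H := H _.
have f0 x : (0 <= (f x + c)%:E)%E.
  by rewrite lee_fin; have := fc x; rewrite ler_norml => /andP[? _]; lra.
have {H} := H f0.
have u1 : uniform_prob (@ltr01 R) setT = 1%E by exact: (@probability_setT _ _ _ (uniform_prob (@ltr01 R))).
have -> : (\int[uniform_prob (@ltr01 R)]_x (f x + c)%:E =
    \int[uniform_prob (@ltr01 R)]_x (f x)%:E + c%:E)%E.
  under eq_integral do rewrite EFinD.
  rewrite integralD//; last exact: finite_measure_integrable_cst.
  by rewrite integral_cst//; congr (_ + _)%E; rewrite -[RHS]mule1; congr (_ * _)%E.
have -> : (\int[@lebesgue_measure R]_(x in `[0%R, 1%R]) (f x + c)%:E =
    \int[@lebesgue_measure R]_(x in `[0%R, 1%R]) (f x)%:E + c%:E)%E.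
  under eq_integral do rewrite EFinD.
  rewrite integralD//.
  by rewrite integral_cst//; congr (_ + _)%E; rewrite -[RHS]mule1; congr (_ * _)%E.
move=> H; have := congr1 (fun z => z - c%:E)%E H.
rewrite !addeK// => ->; rewrite /RintI /Rintegral fineK//.
exact: integrable_fin_num.
Qed.

(** * The exceptional event *)

Section GoodEvent.
Context {R : realType} {d : measure_display} {T : measurableType d}.
Variables (P : probability T R) (n : nat) (X e : nat -> T -> R).
Hypothesis iid : iid_model P n X e.
Hypothesis n0 : (0 < n)%N.
Variables (a : nat -> R -> R) (om : nat -> R) (K0 u : R).
Hypothesis al2 : forall nu, l2 (a nu).
Hypothesis om0 : forall nu, 0 < om nu.
Hypothesis K00 : 0 < K0.
Hypothesis bessel : forall k x, 0 <= x <= 1 -> \sum_(nu < k) a nu x ^+ 2 <= K0.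
Hypothesis om_sum : forall k, \sum_(nu < k) (om nu)^-1 <= K0.
Hypothesis aV : forall mu nu, Vf (a mu) (a nu) = (mu == nu)%:R / om mu.
Hypothesis u0 : 0 <= u.
Hypothesis u2 : ln 2 <= u ^+ 2.

(* Sobolev functions are unconstrained, possibly non-measurable, off [[0,1]]:
   they are cut off before being composed with the data. *)
Let I : set R := `[(0:R), 1]%classic.
Let hs (p q : nat) (z : R) : R := a p z * a q z - (p == q)%:R / om p.

Lemma restrict_in (f : R -> R) x : 0 <= x <= 1 -> (f \_ I) x = f x.
Proof. by move=> x01; rewrite patchE mem_set//= in_itv. Qed.

Lemma restrict_out (f : R -> R) x : ~~ (0 <= x <= 1) -> (f \_ I) x = 0.
Proof. by move=> /negbTE x01; rewrite patchE mem_setE in_itv/= x01. Qed.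

Lemma measurable_restrict_unit (f : R -> R) :
  measurable_fun `[(0:R), 1] f -> measurable_fun setT (f \_ I).
Proof.
move=> mf; have mI : measurable I by exact: measurable_itv.
exact: (measurable_restrictT f mI).1.
Qed.

Lemma measurable_hs p q : measurable_fun `[(0:R), 1] (hs p q).
Proof.
have [mp _] := al2 p; have [mq _] := al2 q.
by apply: measurable_funB => //; apply: measurable_funM.
Qed.

(** Centering changes only the diagonal, where both parts are nonnegative and the cross term has a
    favorable sign. The squared norm is therefore at most the sum of the two squares instead of
    twice that sum. *)
Lemma hs_sum k z : 0 <= z <= 1 ->
  \sum_(p < k) \sum_(q < k) hs p q z ^+ 2 <= 2 * K0 ^+ 2.
Proof.
move=> z01; pose A := \sum_(p < k) a p z ^+ 2; pose W := \sum_(p < k) (om p)^-1.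
have A0 : 0 <= A by apply: sumr_ge0 => i _; exact: sqr_ge0.
have W0 : 0 <= W by apply: sumr_ge0 => i _; rewrite invr_ge0 ltW.
have AK : A ^+ 2 <= K0 ^+ 2.
  by rewrite lerXn2r ?nnegrE ?(ltW K00)//; exact: bessel.
have WK : W ^+ 2 <= K0 ^+ 2 by rewrite lerXn2r ?nnegrE ?(ltW K00)//; exact: om_sum.
apply: (@le_trans _ _ (A ^+ 2 + W ^+ 2)); last by lra.
have -> : A ^+ 2 = \sum_(p < k) \sum_(q < k) a p z ^+ 2 * a q z ^+ 2.
  by rewrite expr2 /A big_distrlr.
apply: (@le_trans _ _ (\sum_(p < k) (\sum_(q < k) a p z ^+ 2 * a q z ^+ 2 + (om p)^-1 ^+ 2))).
  apply: ler_sum => p _.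
  rewrite (bigD1 p)//= [X in _ <= X + _](bigD1 p)//= addrAC.
  apply: lerD.
    rewrite /hs eqxx mul1r.
    have : 0 <= a p z ^+ 2 * (om p)^-1 by rewrite mulr_ge0 ?sqr_ge0// invr_ge0 ltW.
    set t := (om p)^-1; nra.
  apply: ler_sum => q qp; rewrite /hs (_ : (_ == _) = false) ?mul0r ?subr0 ?exprMn//.
  by apply/negbTE; rewrite eq_sym.
rewrite big_split/= lerD2l expr2 /W mulr_suml; apply: ler_sum => p _.
rewrite expr2 ler_wpM2l ?invr_ge0 ?(ltW (om0 p))//.
by rewrite (bigD1 p)//= lerDl sumr_ge0// => i _; rewrite invr_ge0 ltW.
Qed.

Lemma hs_restrict_nrm k z :
  nrm (fun p : 'I_k * 'I_k => (hs p.1 p.2 \_ I) z) <= Num.sqrt (2 * K0 ^+ 2).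
Proof.
rewrite /nrm ler_wsqrtr//.
have [z01|z01] := boolP (0 <= z <= 1); last first.
  rewrite /dot big1; first by rewrite mulr_ge0 ?sqr_ge0.
  by move=> p _; rewrite restrict_out// mul0r.
apply: le_trans (hs_sum k z01); rewrite /dot.
rewrite -(pair_bigA _ (fun p q : 'I_k => (hs p q \_ I) z * (hs p q \_ I) z))/=.
by apply: ler_sum => p _; apply: ler_sum => q _; rewrite !restrict_in// expr2.
Qed.

Lemma a_restrict_nrm k z :
  nrm (fun p : 'I_k => (a p \_ I) z) <= Num.sqrt K0.
Proof.
rewrite /nrm ler_wsqrtr//.
have [z01|z01] := boolP (0 <= z <= 1); last first.
  rewrite /dot big1; first exact: ltW.
  by move=> p _; rewrite restrict_out// mul0r.
apply: le_trans (bessel k z01); rewrite /dot.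
by apply: ler_sum => p _; rewrite !restrict_in// expr2.
Qed.

Lemma hs_centered p q :
  (\int[uniform_prob (@ltr01 R)]_z ((hs p q \_ I) z)%:E = 0)%E.
Proof.
(* Any level beyond both indices serves: the entry is then bounded by the norm of the whole
   truncated matrix. *)
pose k := (maxn p q).+1.
have pk : (p < k)%N by rewrite ltnS leq_maxl.
have qk : (q < k)%N by rewrite ltnS leq_maxr.
rewrite (@uniform_integral _ _ (Num.sqrt (2 * K0 ^+ 2))); last 2 first.
- exact: measurable_restrict_unit (measurable_hs p q).
- move=> x; apply: le_trans (hs_restrict_nrm k x).
  rewrite -(@ler_pXn2r _ 2)// ?nnegrE ?nrm_ge0// sqr_nrm real_normK ?num_real//.
  rewrite /dot (bigD1 (Ordinal pk, Ordinal qk))//= -expr2 lerDl sumr_ge0// => i _.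
  by rewrite -expr2 sqr_ge0.
congr EFin; have i1 := l2_mul (al2 p) (al2 q).
transitivity (RintI 0 1 (fun z => a p z * a q z - (p == q)%:R / om p)).
  apply: eq_Rintegral => x; rewrite inE => xI; apply: (restrict_in (hs p q)).
  by move: xI; rewrite /= in_itv.
rewrite /RintI RintegralB//; last first.
  apply: measurable_bounded_integrable => //.
    by rewrite /= lebesgue_measure_itv/= lte_fin ltr01 oppr0 adde0 ltry.
  by exists `|(p == q)%:R / om p|; split; rewrite ?num_real// => M /ltW h x _.
rewrite Rintegral_cst//= lebesgue_measure_itv/= lte_fin ltr01 oppr0 adde0 mulr1.
by have := aV p q; rewrite /Vf /RintI => ->; rewrite subrr.
Qed.

Lemma sum_pair_mono (F : nat -> nat -> R) k : (forall i j, 0 <= F i j) ->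
  \sum_(p < k) \sum_(q < k) F p q <= \sum_(p < k.+1) \sum_(q < k.+1) F p q.
Proof.
move=> F0; rewrite [leRHS]big_ord_recr /=.
apply: le_trans (_ : _ <= \sum_(p < k) \sum_(q < k.+1) F p q) _.
  by apply: ler_sum => p _; rewrite big_ord_recr /= lerDl.
by rewrite lerDl; apply: sumr_ge0.
Qed.

(** [E] collects the null event that some design point leaves the unit interval and, for each of the
    two deviations, the increasing union over all truncation levels. Increasing unions keep the
    bound [expR (- u ^+ 2)], so no sum over levels arises. *)
Lemma good_event : exists E : set T, [/\ measurable E,
  (P E <= (2 * expR (- u ^+ 2))%:E)%E &
  forall w, ~ E w -> [/\ (forall i, (i < n)%N -> 0 <= X i w <= 1),
   (forall k, nrm (fun p : 'I_k * 'I_k => \sum_(i < n)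
     (a p.1 (X i w) * a p.2 (X i w) - (p.1 == p.2)%:R / om p.1)) ^+ 2
        <= 32 * n%:R * K0 ^+ 2 * u ^+ 2) &
   (forall k, nrm (fun nu : 'I_k => \sum_(i < n) e i w * a nu (X i w)) ^+ 2
      <= 4 * n%:R * K0 * u ^+ 2)]].
Proof.
pose A1 k := [set w | 16 * n%:R * Num.sqrt (2 * K0 ^+ 2) ^+ 2 * u ^+ 2 <
    dot (fun p : 'I_k * 'I_k => \sum_(i < n) (hs p.1 p.2 \_ I) (X i w))
        (fun p : 'I_k * 'I_k => \sum_(i < n) (hs p.1 p.2 \_ I) (X i w))].
pose A2 k := [set w | 4 * n%:R * Num.sqrt K0 ^+ 2 * u ^+ 2 <
    dot (fun l : 'I_k => \sum_(i < n) e i w * (a l \_ I) (X i w))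
        (fun l : 'I_k => \sum_(i < n) e i w * (a l \_ I) (X i w))].
have sK1 : 0 < Num.sqrt (2 * K0 ^+ 2) by rewrite sqrtr_gt0 mulr_gt0 ?exprn_gt0.
have sK2 : 0 < Num.sqrt K0 by rewrite sqrtr_gt0.
have H1 k : measurable (A1 k) /\ (P (A1 k) <= (expR (- u ^+ 2))%:E)%E.
  apply: (@centered_tail _ _ _ P n X e iid _ (fun p : 'I_k * 'I_k => hs p.1 p.2 \_ I)) => //.
  - by move=> p; exact: measurable_restrict_unit (measurable_hs _ _).
  - by move=> z; exact: hs_restrict_nrm.
  - by move=> p; exact: hs_centered.
have H2 k : measurable (A2 k) /\ (P (A2 k) <= (expR (- u ^+ 2))%:E)%E.
  apply: (@noise_tail _ _ _ P n X e iid _ (fun l : 'I_k => a l \_ I)) => //.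
  - by move=> p; apply: measurable_restrict_unit; case: (al2 p).
  - by move=> z; exact: a_restrict_nrm.
have mA1 k : measurable (A1 k) by case: (H1 k).
have mA2 k : measurable (A2 k) by case: (H2 k).
have PA1 : (P (\bigcup_k A1 k) <= (expR (- u ^+ 2))%:E)%E.
  apply: bigcup_prob_le => // k; last by case: (H1 k).
  move=> w; rewrite /A1 /= => /lt_le_trans; apply; rewrite /dot.
  pose F p q := \sum_(i < n) (hs p q \_ I) (X i w).
  rewrite -(pair_bigA _ (fun p q : 'I_k => F p q * F p q))/=.
  rewrite -(pair_bigA _ (fun p q : 'I_k.+1 => F p q * F p q))/=.
  by apply: (@sum_pair_mono (fun p q => F p q * F p q)) => p q; rewrite -expr2 sqr_ge0.
have PA2 : (P (\bigcup_k A2 k) <= (expR (- u ^+ 2))%:E)%E.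
  apply: bigcup_prob_le => // k; last by case: (H2 k).
  move=> w; rewrite /A2 /= => /lt_le_trans; apply; rewrite /dot.
  by rewrite big_ord_recr /= lerDl -expr2 sqr_ge0.
have mX i : measurable_fun setT (X i) by case: iid => m _ _ _; case: (m i).
pose B i := X i @^-1` (~` `[(0:R), 1]%classic).
have mI : measurable (~` `[(0:R), 1]%classic) by apply: measurableC.
have mB i : measurable (B i) by rewrite -[X in measurable X]setTI; exact: mX.
have PB i : (i < n)%N -> P (B i) = 0.
  case: iid => _ /(_ i) H _ _ iln; rewrite (H _ iln mI) /uniform_prob.
  apply: integral0_eq => x; rewrite /= in_itv/= /uniform_pdf => /negP/negbTE ->.
  by [].
pose E0 := \big[setU/set0]_(i < n) B i.
have mE0 : measurable E0 by apply: bigsetU_measurable.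
have PE0 : P E0 = 0.
  apply/eqP; rewrite eq_le measure_ge0 andbT.
  have BI : (P E0 <= \sum_(i < n) P (B i))%E by exact: Boole_inequality.
  apply: (le_trans BI).
  by rewrite big1// => i _; exact: PB.
have mU1 : measurable (\bigcup_k A1 k) by exact: bigcupT_measurable.
have mU2 : measurable (\bigcup_k A2 k) by exact: bigcupT_measurable.
exists (E0 `|` (\bigcup_k A1 k `|` \bigcup_k A2 k)); split.
- by apply: measurableU => //; exact: measurableU.
- have b1 : (P (E0 `|` (\bigcup_k A1 k `|` \bigcup_k A2 k)) <=
      P E0 + P (\bigcup_k A1 k `|` \bigcup_k A2 k))%E.
    by apply: measureU2 => //; exact: measurableU.
  have b2 : (P (\bigcup_k A1 k `|` \bigcup_k A2 k) <=
      P (\bigcup_k A1 k) + P (\bigcup_k A2 k))%E by exact: measureU2.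
  apply: (le_trans b1); rewrite PE0 add0e; apply: (le_trans b2).
  have -> : 2 * expR (- u ^+ 2) = expR (- u ^+ 2) + expR (- u ^+ 2) by ring.
  by rewrite EFinD; exact: leeD.
move=> w /not_orP[nE0 /not_orP[nA1 nA2]].
have X01 i : (i < n)%N -> 0 <= X i w <= 1.
  move=> iln; apply/negP => /negP Xi; apply: nE0; rewrite /E0.
  rewrite -bigcup_mkord; exists i => //=; rewrite /B /= in_itv/=.
  exact/negP.
split => // k.
- rewrite leNgt; apply/negP => h; apply: nA1; exists k => //.
  rewrite /A1 /= sqr_sqrtr; last by rewrite mulr_ge0 ?sqr_ge0.
  have -> : 16 * n%:R * (2 * K0 ^+ 2) * u ^+ 2 = 32 * n%:R * K0 ^+ 2 * u ^+ 2 by ring.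
  apply: (lt_le_trans h); rewrite sqr_nrm; apply: eq_ler; apply: eq_bigr => p _.
  by congr (_ * _); apply: eq_bigr => i _; rewrite restrict_in// X01.
- rewrite leNgt; apply/negP => h; apply: nA2; exists k => //.
  rewrite /A2 /= sqr_sqrtr ?(ltW K00)//.
  apply: (lt_le_trans h); rewrite sqr_nrm; apply: eq_ler; apply: eq_bigr => p _.
  by congr (_ * _); apply: eq_bigr => i _; rewrite restrict_in// X01.
Qed.

End GoodEvent.

(** * The Bahadur remainder *)

Section Remainder.
Context {R : realType}.
Variables (m n : nat) (lam : R) (K : R -> R -> R) (Pl : (R -> R) -> R -> R).
Hypothesis n0 : (0 < n)%N.
Hypothesis lam0 : 0 < lam.
Local Notation S := (Sobolev m).
Local Notation N := (normS m lam).
Hypothesis KS : forall x, 0 <= x <= 1 -> S (K x).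
Hypothesis Krep : forall x f, 0 <= x <= 1 -> S f -> inner m lam (K x) f = f x.
Hypothesis PlS : forall g, S g -> S (Pl g).
Hypothesis Plrep : forall f g, S f -> S g -> inner m lam f (Pl g) = lam * Jf m f g.

(** The bias. The squared norm is [lam * Jf m (Pl f) f]; Cauchy-Schwarz for [Jf], together with
    [lam * Jf m (Pl f) (Pl f)] being at most the squared norm, bounds its square by [lam] times
    itself. *)
Lemma normS_Pl_le f : S f -> Jf m f f <= 1 -> N (Pl f) <= Num.sqrt lam.
Proof.
move=> Sf J1; have SP := PlS Sf.
have E : N (Pl f) ^+ 2 = lam * Jf m (Pl f) f by rewrite sqr_normS// Plrep.
have h1 := Jf_CS SP Sf.
have h2 : lam * Jf m (Pl f) (Pl f) <= N (Pl f) ^+ 2.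
  by rewrite sqr_normS// /inner lerDr Vf_ge0.
have p0 := Jf_ge0 m (Pl f).
have h3 : (N (Pl f) ^+ 2) ^+ 2 <= lam * N (Pl f) ^+ 2.
  rewrite {1}E exprMn expr2 -mulrA ler_pM2l//.
  apply: le_trans h2; rewrite ler_pM2l//; apply: (le_trans h1).
  by rewrite ler_piMr.
have sl : Num.sqrt lam ^+ 2 = lam by rewrite sqr_sqrtr// ltW.
rewrite -(@ler_pXn2r _ 2)// ?nnegrE ?normS_ge0 ?sqrtr_ge0// sl.
have [->|nz] := eqVneq (N (Pl f) ^+ 2) 0; first exact: ltW.
have pz : 0 < N (Pl f) ^+ 2 by rewrite lt_neqAle eq_sym nz sqr_ge0.
by rewrite -(ler_pM2r pz) -expr2.
Qed.

Variables (xs eps : nat -> R) (F f : R -> R) (T1 T2 : R).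
Hypothesis xs01 : forall i, (i < n)%N -> 0 <= xs i <= 1.
Hypothesis SF : S F.
Hypothesis Sf : S f.
Hypothesis J1 : Jf m f f <= 1.
Hypothesis opt : forall g, S g ->
  objective m n lam xs (fun i => f (xs i) + eps i) g <=
  objective m n lam xs (fun i => f (xs i) + eps i) F.
Hypothesis T10 : 0 <= T1.
Hypothesis T20 : 0 <= T2.
Hypothesis emp : forall g u, S g -> S u ->
  `|\sum_(i < n) g (xs i) * u (xs i) - n%:R * Vf g u| <= T1 * (N g * N u).
Hypothesis noise : forall u, S u -> `|\sum_(i < n) eps i * u (xs i)| <= T2 * N u.

Let W x := \sum_(i < n) eps i * K (xs i) x.
(** The estimation error; [W] is the unnormalized noise term and [Q] the Bahadur remainder. The
    scalars are explicit to match the linearity lemmas. *)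
Let g x := 1 * F x + (-1) * f x.
Let Q x := F x - f x - (n%:R^-1 * \sum_(i < n) eps i * K (xs i) x - Pl f x).

Let KSi i : (i < n)%N -> S (K (xs i)).
Proof. by move=> iln; apply: KS; exact: xs01. Qed.

Let SW : S W.
Proof. exact: (@Sobolev_sum _ m n eps (fun i => K (xs i)) KSi). Qed.

Let Sg : S g.
Proof. exact: Sobolev_lin. Qed.

Let ipW u : S u -> inner m lam W u = \sum_(i < n) eps i * u (xs i).
Proof.
move=> Su; rewrite (@inner_sum _ m lam n eps (fun i => K (xs i)) u KSi Su).
by apply: eq_bigr => i _; rewrite Krep//; exact: xs01.
Qed.

Let QE : Q = (fun x => 1 * (1 * g x + (- n%:R^-1) * W x) + 1 * Pl f x).
Proof. by apply/funext => x; rewrite /Q /g /W; ring. Qed.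

Let SP : S (Pl f). Proof. exact: PlS. Qed.
Let SgW : S (fun x => 1 * g x + (- n%:R^-1) * W x). Proof. exact: Sobolev_lin. Qed.
Let SQ : S Q. Proof. by rewrite QE; exact: Sobolev_lin. Qed.

(** [W] represents the noise functional, so testing the functional on [W] itself gives the norm. *)
Lemma normS_noise_le : N W <= T2.
Proof.
have h := noise SW; rewrite -ipW// -sqr_normS// ger0_norm ?sqr_ge0// in h.
have [->|nz] := eqVneq (N W) 0; first exact: T20.
have pz : 0 < N W by rewrite lt_neqAle eq_sym nz normS_ge0.
by rewrite -(ler_pM2r pz) -expr2.
Qed.

Lemma remainder_le : n%:R * N Q <= T1 * N g.
Proof.
have nn : n%:R != 0 :> R by rewrite pnatr_eq0 -lt0n.
(* The first-order condition is tested with [Q] itself. The penalty on [F] cancels against it and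
   the penalty on [f] against [Pl f]; only the covariance deviation at [g] and [Q] survives. *)
have E : n%:R * N Q ^+ 2 = - (\sum_(i < n) g (xs i) * Q (xs i) - n%:R * Vf g Q).
  have foc := first_order_condition n0 SF SQ opt.
  rewrite sqr_normS// {1}QE inner_lin// inner_lin// ipW//.
  rewrite (inner_sym _ _ (Pl f)) Plrep// (Jf_sym _ Q f).
  rewrite /g inner_lin// Vf_lin; [|exact: Sobolev_l2 SF|exact: Sobolev_l2 Sf|exact: Sobolev_l2 SQ].
  have -> : \sum_(i < n) (1 * F (xs i) + -1 * f (xs i)) * Q (xs i) =
     \sum_(i < n) eps i * Q (xs i) - n%:R * (lam * Jf m F Q).
    by rewrite -foc -sumrB; apply: eq_bigr => i _; ring.
  rewrite /inner; set s := \sum_(i < n) _; set a := Vf F Q; set b := Vf f Q.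
  set c := Jf m F Q; set e := Jf m f Q.
  by field.
have h := emp Sg SQ; have h2 := ler_norm (- (\sum_(i < n) g (xs i) * Q (xs i) - n%:R * Vf g Q)).
rewrite normrN -E in h2.
have h3 : n%:R * N Q ^+ 2 <= T1 * N g * N Q by rewrite -mulrA; exact: le_trans h2 h.
have [->|nz] := eqVneq (N Q) 0; first by rewrite mulr0 mulr_ge0// normS_ge0.
have pz : 0 < N Q by rewrite lt_neqAle eq_sym nz normS_ge0.
by rewrite -(ler_pM2r pz) -mulrA -expr2.
Qed.

Lemma estimation_error_le : N g <= N Q + n%:R^-1 * T2 + Num.sqrt lam.
Proof.
have gE : g = (fun x => 1 * (1 * Q x + n%:R^-1 * W x) + (-1) * Pl f x).
  by apply/funext => x; rewrite /g /Q /W; ring.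
have SQW : S (fun x => 1 * Q x + n%:R^-1 * W x) by exact: Sobolev_lin.
rewrite gE; apply: (le_trans (normS_triangle lam0 1 (-1) SQW SP)).
rewrite normrN !normr1 !mul1r; apply: lerD; last exact: normS_Pl_le.
have := normS_triangle lam0 1 n%:R^-1 SQ SW; rewrite normr1 !mul1r => /le_trans; apply.
by rewrite lerD2l ger0_norm ?invr_ge0// ler_wpM2l ?invr_ge0//; exact: normS_noise_le.
Qed.

End Remainder.

(** The first summand is nonnegative. In the second the exponent is nonnegative, so the logarithm is
    at least ln (3/2), the square of [tau]; the roots cancel, and sqrt 6 >= 2 with [eps = 2] leaves
    20 * 2 * 2. *)
Lemma Afun_ge80 {R : realType} m (ck c0 h : R) : 0 <= ck -> 0 <= c0 ->
  80 <= Afun m ck c0 h 2.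
Proof.
move=> ck0 c00; rewrite /Afun.
have ln32 : 0 < ln (3 / 2 : R) by rewrite ln_gt0//; lra.
have tau0 : 0 < tau :> R by rewrite /tau sqrtr_gt0.
have P0 r : 0 <= Psi m r :> R by apply: Rintegral_ge0 => x _; exact: sqrtr_ge0.
set y := 2 * c0 * _.
have y0 : 0 <= y by rewrite /y mulr_ge0 ?powR_ge0// mulr_ge0.
have s6 : 2 <= Num.sqrt 6 :> R.
  by rewrite -(@ler_pXn2r _ 2)// ?nnegrE ?sqrtr_ge0// sqr_sqrtr//; lra.
have st : tau <= Num.sqrt (ln (1 + expR y)).
  rewrite /tau ler_sqrt; last first.
    by rewrite ln_ge0// lerDl expR_ge0.
  rewrite ler_ln ?posrE ?addr_gt0 ?expR_gt0//.
  have := expR_ge1Dx y; lra.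
apply: le_trans (_ : _ <= 20 * Num.sqrt 6 * 2 / tau * Num.sqrt (ln (1 + expR y))) _.
  rewrite mulrAC ler_pdivlMr//.
  set s := Num.sqrt 6 in s6 *; set q := Num.sqrt _ in st *; nra.
rewrite lerDr; apply: mulr_ge0; last exact: P0.
apply: mulr_ge0; last exact: powR_ge0.
apply: mulr_ge0; last by rewrite exprn_ge0.
apply: mulr_ge0; last by rewrite invr_ge0.
apply: mulr_ge0; last by rewrite invr_ge0 ltW.
by apply: mulr_ge0; rewrite ?sqrtr_ge0.
Qed.

(** * The constant c_K as a bound for the kernel diagonal *)

Section KernelConstant.
Context {R : realType}.
Variables (h C : R) (K : R -> R -> R).
Hypothesis h0 : 0 < h.
Hypothesis KC : forall x, 0 <= x <= 1 -> K x x <= C.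

Lemma cK_ge x : 0 <= x <= 1 -> Num.sqrt (h * K x x) <= cK h K.
Proof.
move=> x01; apply: ub_le_sup; last by exists x => //=; rewrite in_itv.
exists (Num.sqrt (h * C)) => _ [y /= + <-]; rewrite in_itv/= => y01.
by apply: ler_wsqrtr; rewrite ler_pM2l//; exact: KC.
Qed.

Lemma cK_ge0 : 0 <= cK h K.
Proof.
by apply: le_trans (@cK_ge 0 _); rewrite ?sqrtr_ge0 ?lexx ?ler01.
Qed.

Lemma K_le_cK x : 0 <= x <= 1 -> K x x <= cK h K ^+ 2 / h.
Proof.
move=> x01; rewrite ler_pdivlMr// mulrC.
have [k0|k0] := leP (h * K x x) 0; first exact: le_trans (sqr_ge0 _).
rewrite -[leLHS]sqr_sqrtr ?(ltW k0)// lerXn2r ?nnegrE ?sqrtr_ge0 ?cK_ge0//.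
exact: cK_ge.
Qed.

Lemma cK_gt0 x : 0 <= x <= 1 -> 0 < K x x -> 0 < cK h K.
Proof.
by move=> x01 Kx; apply: lt_le_trans (cK_ge x01); rewrite sqrtr_gt0 mulr_gt0.
Qed.

End KernelConstant.

Theorem theorem3p4 (R : realType) (m : nat) (h r M c0 : R)
    (K : R -> R -> R) (Pl : (R -> R) -> R -> R)
    (fhat : (nat -> R) -> (nat -> R) -> R -> R)
    (d : measure_display) (T : measurableType d) (P : probability T R)
    (n : nat) (X e : nat -> T -> R) :
  let lam := h ^+ (2 * m) in
  (1 <= m)%N -> (0 < n)%N -> 0 < h -> 0 < r -> 0 < M ->
  A1 m lam ->
  (* K is the reproducing kernel of (S^m(I), <.,.>) *)
  (forall x, 0 <= x <= 1 -> Sobolev m (K x)) ->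
  (forall x f, 0 <= x <= 1 -> Sobolev m f -> inner m lam (K x) f = f x) ->
  (* P_lambda : <f, P_lambda g> = lambda J(f,g) *)
  (forall g, Sobolev m g -> Sobolev m (Pl g)) ->
  (forall f g, Sobolev m f -> Sobolev m g -> inner m lam f (Pl g) = lam * Jf m f g) ->
  (* the entropy constant c_0 *)
  0 < c0 -> packing_bound m h c0 (Gset m h (cK h K)) ->
  (* the smoothing spline estimator and the data model *)
  is_smoothing_spline m n lam fhat ->
  iid_model P n X e ->
  (cK h K) ^+ 2 * Num.sqrt M * r * powR h (- (2^-1)) * Afun m (cK h K) c0 h 2
    <= 2^-1 ->
  let delta := 2 * h ^+ m
      + cK h K * (Num.sqrt (2 * M) * r + powR (n%:R * h) (- (2^-1))) in
  let gamma := (cK h K) ^+ 2 * Num.sqrt M * r * powR h (- (2^-1))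
      * Afun m (cK h K) c0 h 2 * delta in
  forall f : R -> R, Sobolev m f -> Jf m f f <= 1 ->
    (* outer P_f-probability of the event is at most 2 exp(-M n h r^2) *)
    exists E : set T, [/\ measurable E,
      [set w | gamma <= normS m lam (fun x =>
          fhat (fun i => X i w) (fun i => f (X i w) + e i w) x - f x
          - (n%:R^-1 * \sum_(i < n) e i w * K (X i w) x - Pl f x))] `<=` E &
      (P E <= (2 * expR (- (M * n%:R * h * r ^+ 2)))%:E)%E].
Proof.
move=> lam m1 n0 h0 r0 M0 A1' KS Krep PlS Plrep c00 _ spline iid kappa_le delta gamma f Sf J1.
have lam0 : 0 < lam by rewrite exprn_gt0.
have [phi [rho [crho [crho0 [phiS [[B phiB] [_ [rho_cvg [phiV [phiJ phi_cvg]]]]]]]]]] := A1'.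
have nR : 0 < n%:R :> R by rewrite ltr0n.
have [C KC] := K_diag_bounded lam0 m1 KS Krep crho0 phiS phiB rho_cvg phiV phiJ phi_cvg.
(* This makes [cK] positive. If the diagonal were nowhere positive, Bessel's inequality would force
   [phi 0] to vanish, against its unit mass in [V]. *)
have [x1 x101 Kx1] : exists2 x, 0 <= x <= 1 & 0 < K x x.
  apply: contrapT => nK.
  have phi0 x : 0 <= x <= 1 -> phi 0 x = 0.
    move=> x01; apply/eqP; rewrite -sqrf_eq0 eq_le sqr_ge0 andbT.
    have := feat_bessel lam0 KS Krep phiS phiV phiJ phi_cvg 1 x01.
    rewrite big_ord_recl big_ord0 addr0 (sqr_feat lam0 phiJ)/= => H.
    have {H} : phi 0 x ^+ 2 / omega lam rho 0 <= 0.
      by apply: (le_trans H); rewrite leNgt; apply/negP => Kx; apply: nK; exists x.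
    by rewrite pmulr_lle0// invr_gt0 (omega_gt0 lam0 phiJ).
  have := phiV 0%N 0%N; rewrite eqxx (Vf_eq0 phi0) => /esym/eqP.
  by rewrite oner_eq0.
pose ck := cK h K.
have ck0 : 0 < ck := cK_gt0 h0 KC x101 Kx1.
pose K0 := ck ^+ 2 / h.
have K00 : 0 < K0 by rewrite divr_gt0// exprn_gt0.
have KK0 x : 0 <= x <= 1 -> K x x <= K0 by exact: (K_le_cK h0 KC).
pose u := Num.sqrt (M * n%:R * h) * r.
have u0 : 0 <= u by rewrite mulr_ge0 ?sqrtr_ge0// ltW.
have u2 : u ^+ 2 = M * n%:R * h * r ^+ 2.
  by rewrite exprMn sqr_sqrtr// !mulr_ge0// ltW.
rewrite -u2.
have [ln2u|uln2] := leP (ln 2) (u ^+ 2); last first.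
  exists setT; split => //; rewrite probability_setT lee_fin.
  have : expR (- ln 2) <= expR (- u ^+ 2) :> R by rewrite ler_expR lerN2 ltW.
  rewrite expRN lnK ?posrE//; lra.
pose a := feat lam phi rho; pose om := omega lam rho.
have om0 nu : 0 < om nu := omega_gt0 lam0 phiJ nu.
have so nu : Num.sqrt (om nu) != 0 := sqrt_omega_neq0 lam0 phiJ nu.
have aE nu : a nu = (fun x => (Num.sqrt (om nu))^-1 * phi nu x + 0 * phi nu x).
  by apply/funext => x; rewrite /a /feat -/om mul0r addr0 mulrC.
have pl2 nu : l2 (phi nu) := Sobolev_l2 (phiS nu).
have al2 nu : l2 (a nu) by rewrite aE; exact: l2_lin.
have bess k x : 0 <= x <= 1 -> \sum_(nu < k) a nu x ^+ 2 <= K0.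
  move=> x01; apply: le_trans (KK0 x x01).
  exact: (feat_bessel lam0 KS Krep phiS phiV phiJ phi_cvg).
have oms k : \sum_(nu < k) (om nu)^-1 <= K0.
  exact: (sum_inv_omega_le lam0 KS Krep phiS phiV phiJ phi_cvg k KK0).
have aV mu nu : Vf (a mu) (a nu) = (mu == nu)%:R / om mu.
  rewrite (aE mu) Vf_lin// (aE nu) !Vf_linr// !phiV.
  case: (eqVneq mu nu) => [<-|_]; last by rewrite !mulr0 !mul0r !addr0 mulr0.
  have -> : true%:R = 1 :> R by [].
  have := sqr_sqrt_omega lam0 phiJ mu; have := so mu; rewrite -/(om mu).
  by move: (Num.sqrt (om mu)) => q q0 <-; field.
have [E [mE PE HE]] := good_event iid n0 al2 om0 K00 bess oms aV u0 ln2u.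
exists E; split => //.
move=> w /=; apply: contraPP => nE; have [X01 H1 H2] := HE w nE.
pose g12 : R := powR h (- 2^-1).
have g120 : 0 < g12 by rewrite powR_gt0.
have g12s : g12 ^+ 2 = h^-1.
  by rewrite /g12 powRN powR12_sqrt ?(ltW h0)// exprVn sqr_sqrtr// ltW.
pose sM := Num.sqrt M.
have sM0 : 0 < sM by rewrite sqrtr_gt0.
have sM2 : sM ^+ 2 = M by rewrite sqr_sqrtr// ltW.
(* Square roots of the two thresholds of [good_event] after inserting [K0] and [u]: the first has
   sqrt 32 rounded up to 6, the second is exact. *)
pose T1 := 6 * n%:R * ck ^+ 2 * sM * r * g12.
pose T2 := 2 * n%:R * ck * sM * r.
have T10 : 0 <= T1.
  by rewrite /T1; do !apply: mulr_ge0 => //; rewrite ?exprn_ge0 ?ltW.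
have T20 : 0 <= T2.
  by rewrite /T2; do !apply: mulr_ge0 => //; rewrite ?exprn_ge0 ?ltW.
have hn : h != 0 by rewrite gt_eqF.
have H1' k : nrm (fun p : 'I_k * 'I_k => \sum_(i < n)
     (a p.1 (X i w) * a p.2 (X i w) - (p.1 == p.2)%:R / om p.1)) <= T1.
  rewrite -(@ler_pXn2r _ 2)// ?nnegrE ?nrm_ge0//; apply: (le_trans (H1 k)).
  have -> : T1 ^+ 2 = 36 * n%:R ^+ 2 * ck ^+ 4 * M * r ^+ 2 * h^-1.
    by rewrite -sM2 -g12s /T1; ring.
  have -> : 32 * n%:R * K0 ^+ 2 * u ^+ 2 = 32 * (n%:R ^+ 2 * ck ^+ 4 * M * r ^+ 2 * h^-1).
    by rewrite u2 /K0; field.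
  have : 0 <= n%:R ^+ 2 * ck ^+ 4 * M * r ^+ 2 * h^-1.
    by do !apply: mulr_ge0 => //; rewrite ?exprn_ge0 ?invr_ge0 ?ltW.
  lra.
have H2' k : nrm (fun nu : 'I_k => \sum_(i < n) e i w * a nu (X i w)) <= T2.
  rewrite -(@ler_pXn2r _ 2)// ?nnegrE ?nrm_ge0//; apply: (le_trans (H2 k)).
  apply: eq_ler; rewrite u2 /K0 /T2 -sM2; by field.
set xs := fun i => X i w; set F := fhat _ _.
have [SF opt] := spline xs (fun i => f (X i w) + e i w) X01.
have emp g v : Sobolev m g -> Sobolev m v ->
    `|\sum_(i < n) g (xs i) * v (xs i) - n%:R * Vf g v| <= T1 * (normS m lam g * normS m lam v).
  by move=> Sg Sv; apply: (empirical_bound lam0 KS Krep phiS phiV phiJ phi_cvg).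
have noi v : Sobolev m v -> `|\sum_(i < n) e i w * v (xs i)| <= T2 * normS m lam v.
  move=> Sv; exact: (@noise_bound _ _ _ _ lam0 KS Krep _ _ phiS phiV phiJ phi_cvg n xs
    (fun i => e i w) X01 T2 v T20 Sv H2').
have B1 := remainder_le (eps := fun i => e i w) n0 lam0 KS Krep PlS Plrep X01 SF Sf opt T10 emp.
have B2 := estimation_error_le (eps := fun i => e i w) lam0 KS Krep PlS Plrep X01 SF Sf J1 T20 noi.
move: B1 B2; set Q := normS m lam _; set G := normS m lam _ => B1 B2.
have slam : Num.sqrt lam = h ^+ m.
  by rewrite /lam mulnC exprM sqrtr_sqr ger0_norm// exprn_ge0// ltW.
rewrite slam in B2.
apply/negP; rewrite -ltNge.
have A80 := Afun_ge80 m h (ltW ck0) (ltW c00).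
rewrite /gamma; set kap := (X in X * delta); rewrite -/kap in kappa_le.
(* [kap] is [s] times A(h), so [80 * s <= kap <= 1 / 2] and [s <= 1 / 160]. From
   [Q <= 6 * s * (Q + 2 * delta)] the remainder on the right is absorbed, and what is left is about
   12/80 of [kap * delta], well below it. *)
pose s := ck ^+ 2 * sM * r * g12.
have s0 : 0 < s by rewrite /s; do !apply: mulr_gt0 => //; rewrite exprn_gt0.
have kE : kap = s * Afun m ck c0 h 2 by [].
have sk : 80 * s <= kap by rewrite kE mulrC ler_pM2l.
have hm0 : 0 < h ^+ m by rewrite exprn_gt0.
have T2E : n%:R^-1 * T2 = 2 * (ck * (sM * r)).
  by rewrite /T2; field; rewrite gt_eqF.
(* The noise contributes 2 c_K sqrt M r, while [delta] contains c_K sqrt (2 M) r; this is what the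
   factor 2 pays for. *)
have dge : h ^+ m + n%:R^-1 * T2 <= 2 * delta.
  have p1 : sM * r <= Num.sqrt (2 * M) * r + powR (n%:R * h) (- 2^-1).
    rewrite ler_wpDr ?powR_ge0// ler_pM2r// ler_wsqrtr//.
    by have := ltW M0; lra.
  have := ler_wpM2l (ltW ck0) p1; rewrite T2E /delta -/ck; lra.
have d0 : 0 < delta.
  have t0 : 0 <= n%:R^-1 * T2 by rewrite mulr_ge0// invr_ge0.
  have : 0 < 2 * delta by apply: lt_le_trans dge; rewrite ltr_wpDr.
  by rewrite pmulr_rgt0.
have T1E : T1 = n%:R * (6 * s) by rewrite /T1 /s; ring.
have B1' : Q <= 6 * s * G by rewrite -(ler_pM2l nR) mulrA -T1E.
have Q0 : 0 <= Q by exact: normS_ge0.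
have G0 : 0 <= G by exact: normS_ge0.
have B3 : G <= Q + 2 * delta.
  by apply: (le_trans B2); rewrite -addrA lerD2l addrC.
have B4 : 6 * s * G <= 6 * s * (Q + 2 * delta) by rewrite ler_pM2l// mulr_gt0.
have k0 : 0 < kap by apply: lt_le_trans sk; rewrite mulr_gt0.
have B5 : s * Q <= (1 / 160) * Q by rewrite ler_wpM2r//; lra.
have B6 : 80 * (s * delta) <= kap * delta by rewrite mulrA ler_pM2r.
have B7 : 0 < kap * delta by rewrite mulr_gt0.
nra.
Qed.
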